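(* Let $d,n\in\mathbb{N}$, $r>0$, $\hat\alpha=(\alpha_1,\dots,\alpha_d)\in(0,1]^d$, $A,B\in\mathbb{R}^{d\times d}$, $E\in\mathbb{R}^{d\times n}$, $C=(c_{ij})\in\mathbb{R}^{n\times d}$, $D=(d_{ij})\in\mathbb{R}^{n\times n}$, and let $\tau_k:[0,\infty)\to\mathbb{R}_{\ge0}$ ($k=1,2,3$) be continuous with $t-\tau_k(t)\ge -r$ for all $t\ge0$ and $\lim_{t\to\infty}(t-\tau_k(t))=\infty$. Suppose that $A$ is Metzler, $B,C,D,E$ are nonnegative, $A+B+E(I_n-D)^{-1}C$ is Hurwitz, and: (i) $\sum_{k=1}^d|c_{ik}|<1$ and $\sum_{j=1}^n|d_{ij}|<1$ for all $i=1,\dots,n$; (ii) the matrix $H=(h_{ij})_{1\le i\le n,1\le j\le d}:=(I_n-D)^{-1}C$ is such that for each $i\in\{1,\dots,n\}$ there exists $j\in\{1,\dots,d\}$ with $h_{ij}>0$. Let $f_0\in C([0,\infty);\mathbb{R}^d_{\ge0})$ and $g_0\in C([0,\infty);\mathbb{R}^n_{\ge0})$ be bounded, with componentwise suprema $F:=\sup_{t\ge0}f_0(t)\in\mathbb{R}^d_{\ge 0}$ and $G:=\sup_{t\ge0}g_0(t)\in\mathbb{R}^n_{\ge 0}$. Let $\psi\in C([-r,0];\mathbb{R}^d_{\ge0})$ and $\varphi\in C([-r,0];\mathbb{R}^n_{\ge0})$ satisfy $C\psi(0)+D\varphi(-\tau_3(0))+g_0(0)=\varphi(0)$. Let $\mathcal{F}$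 be the set of $f\in C([0,\infty);\mathbb{R}^d_{\ge0})$ with $f(t)\preceq F$ for all $t\ge0$, and let $\mathcal{G}$ be the set of $g\in C([0,\infty);\mathbb{R}^n_{\ge0})$ with $g(t)\preceq G$ for all $t\ge0$ and $C\psi(0)+D\varphi(-\tau_3(0))+g(0)=\varphi(0)$. For $f\in\mathcal{F}$, $g\in\mathcal{G}$ let $\Phi_{f,g}(\cdot;\psi,\varphi)=(x,y)^{\rm T}$ be the solution of $$\begin{cases}{}^{C}D^{\hat\alpha}_{0^+}x(t)=Ax(t)+Bx(t-\tau_1(t))+Ey(t-\tau_2(t))+f(t), & t\in(0,\infty),\\ y(t)=Cx(t)+Dy(t-\tau_3(t))+g(t), & t\in[0,\infty),\\ x(t)=\psi(t),\ y(t)=\varphi(t), & t\in[-r,0].\end{cases}$$ Then, with $\sup$ and $\limsup$ taken componentwise, $$\sup_{f\in\mathcal{F},\,g\in\mathcal{G}}\ \limsup_{t\to\infty}\Phi_{f,g}(t;\psi,\varphi)=(x^*,y^* )^{\rm T},$$ where $x^*:=-[A+B+E(I_n-D)^{-1}C]^{-1}[F+E(I_n-D)^{-1}G]$ and $y^*:=(I_n-D)^{-1}(Cx^*+G)$.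
   Context: For $\alpha\in(0,1]$, $I^\alpha_{0^+}u(t)=\frac{1}{\Gamma(\alpha)}\int_0^t(t-s)^{\alpha-1}u(s)\,ds$ (with $I^0_{0^+}u=u$), and the Caputo fractional derivative is ${}^{C}D^{\alpha}_{0^+}u(t)=\frac{d}{dt}I^{1-\alpha}_{0^+}(u(t)-u(0))$ for $t>0$; ${}^{C}D^{\hat\alpha}_{0^+}x(t)=({}^{C}D^{\alpha_1}_{0^+}x_1(t),\dots,{}^{C}D^{\alpha_d}_{0^+}x_d(t))^{\rm T}$. A square matrix is Metzler if its off-diagonal entries are nonnegative, and Hurwitz if all its eigenvalues have negative real part; a matrix is nonnegative if all its entries are; $\preceq$ is the entrywise order. The solution is the (under the row-sum conditions, unique) continuous function $[-r,\infty)\to\mathbb{R}^{d+n}$ satisfying the equations and the initial condition. *)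

(* Defs.v *)
From HB Require Import structures.
From mathcomp Require Import all_boot all_order all_algebra.
From mathcomp Require Import complex.
From mathcomp Require Import all_classical all_reals all_analysis.

Set Implicit Arguments.
Unset Strict Implicit.
Unset Printing Implicit Defensive.

Import Order.TTheory GRing.Theory Num.Theory.
Import numFieldNormedType.Exports.

Local Open Scope classical_set_scope.
Local Open Scope ring_scope.

Definition nonneg_mx (R : numDomainType) (m p : nat) (M : 'M[R]_(m, p)) : Prop :=
  forall i j, 0 <= M i j.

Definition lemx (R : numDomainType) (m p : nat) (M N : 'M[R]_(m, p)) : Prop :=
  forall i j, M i j <= N i j.

Definition metzler (R : numDomainType) (m : nat) (M : 'M[R]_m) : Prop :=
  forall i j, i != j -> 0 <= M i j.

(* Eigenvalues are complex: [M] is mapped into the matrices over [R[i]]. *)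
Definition hurwitz (R : rcfType) (m : nat) (M : 'M[R]_m) : Prop :=
  forall z : R[i], eigenvalue (map_mx (real_complex R) M) z -> complex.Re z < 0.

Definition Gamma (R : realType) (a : R) : R :=
  \int[@lebesgue_measure R]_(s in `]0, +oo[) (s `^ (a - 1) * expR (- s)).

(* Meant for [0 <= a <= 1]; [I^0] is the identity by convention. *)
Definition fracint (R : realType) (a : R) (u : R -> R) (t : R) : R :=
  if a == 0 then u t
  else (Gamma a)^-1 *
       \int[@lebesgue_measure R]_(s in `[0, t]) ((t - s) `^ (a - 1) * u s).

(* [caputo a u t] is the derivative of [caputo_prim a u] at [t]; as [derive1] is
   total, the existence of this derivative is the separate condition
   [caputo_derivable a u t]. *)
Definition caputo_prim (R : realType) (a : R) (u : R -> R) : R -> R :=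
  fracint (1 - a) (fun s => u s - u 0).

Definition caputo_derivable (R : realType) (a : R) (u : R -> R) (t : R) : Prop :=
  derivable (caputo_prim a u) t 1.

Definition caputo (R : realType) (a : R) (u : R -> R) (t : R) : R :=
  derive1 (caputo_prim a u) t.

Definition caputo_vec (R : realType) (d : nat) (alpha : 'I_d -> R)
    (x : R -> 'cV[R]_d) (t : R) : 'cV[R]_d :=
  \col_i caputo (alpha i) (fun s => x s i 0) t.

(* A function on an interval is a total function on [R], constrained (continuity,
   sign, equations) only on that interval. *)

Definition delay (R : realType) (r : R) (tau : R -> R) : Prop :=
  [/\ {within `[0, +oo[, continuous tau},
      forall t, 0 <= t -> 0 <= tau t,
      forall t, 0 <= t -> - r <= t - tau t
    & (t - tau t) @[t --> +oo] --> +oo].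

Definition cont_nonneg (R : realType) (m : nat) (I : set R) (f : R -> 'cV[R]_m) : Prop :=
  {within I, continuous f} /\ forall t, I t -> nonneg_mx (f t).

Definition bounded_vec (R : realType) (m : nat) (I : set R) (f : R -> 'cV[R]_m) : Prop :=
  exists K : R, forall t, I t -> forall i, `|f t i 0| <= K.

Definition sup_vec (R : realType) (m : nat) (I : set R) (f : R -> 'cV[R]_m) : 'cV[R]_m :=
  \col_i sup [set f t i 0 | t in I].

Definition is_solution (R : realType) (d n : nat) (r : R) (alpha : 'I_d -> R)
    (A B : 'M[R]_d) (E : 'M[R]_(d, n)) (C : 'M[R]_(n, d)) (D : 'M[R]_n)
    (tau1 tau2 tau3 : R -> R) (f : R -> 'cV[R]_d) (g : R -> 'cV[R]_n)
    (psi : R -> 'cV[R]_d) (phi : R -> 'cV[R]_n) (z : R -> 'cV[R]_(d + n)) : Prop :=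
  let x := fun t => usubmx (z t) in
  let y := fun t => dsubmx (z t) in
  [/\ {within `[- r, +oo[, continuous z},
      forall t, 0 < t ->
        (forall i, caputo_derivable (alpha i) (fun s => x s i 0) t) /\
        caputo_vec alpha x t =
          A *m x t + B *m x (t - tau1 t) + E *m y (t - tau2 t) + f t,
      forall t, 0 <= t -> y t = C *m x t + D *m y (t - tau3 t) + g t
    & forall t, - r <= t <= 0 -> x t = psi t /\ y t = phi t].

Definition input_class (R : realType) (m : nat) (F : 'cV[R]_m) : set (R -> 'cV[R]_m) :=
  [set f | cont_nonneg `[0, +oo[ f /\ forall t, 0 <= t -> lemx (f t) F].

(* [v0], [w0], [y0] stand for [psi 0], [phi (- tau3 0)], [phi 0]. *)
Definition compat_input_class (R : realType) (d n : nat) (G : 'cV[R]_n)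
    (C : 'M[R]_(n, d)) (D : 'M[R]_n) (v0 : 'cV[R]_d) (w0 y0 : 'cV[R]_n) :
    set (R -> 'cV[R]_n) :=
  [set g | input_class G g /\ C *m v0 + D *m w0 + g 0 = y0].

Definition limsup_pinfty (R : realType) (u : R -> R) : \bar R :=
  limf_esup (fun t => (u t)%:E) (pinfty_nbhs R).

(* Main.v *)
Require Import Defs.
From HB Require Import structures.
From mathcomp Require Import all_boot all_order all_algebra.
From mathcomp Require Import complex ring lra zify.
From mathcomp Require Import all_classical all_reals all_analysis.
From mathcomp Require Import measurable_realfun.

Import Order.TTheory GRing.Theory Num.Theory.
Import numFieldNormedType.Exports.

Local Open Scope classical_set_scope.
Local Open Scope ring_scope.

(** Let M = A + B + E (I - D)^-1 C.  The point (xstar, ystar) is the equilibrium of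
    the system with the constant inputs F and G, so the deviation
    e = (x, y) - (xstar, ystar) solves the same linear system with the nonpositive
    inputs f - F and g - G.  A comparison statement, [subsystem_decay], says that
    functions which are subsolutions of the homogeneous system from some time on
    have nonpositive upper limits.  Applied to e, it bounds every upper limit by
    (xstar, ystar).  Applied to - e when the inputs are equal to F and G from time 1 on,
    it shows that the solution then converges to (xstar, ystar), so that the supremum is
    attained.  The value g(0) is prescribed by the compatibility condition, which
    is why the extremal g has to move from g0(0) to G first.

    The comparison rests on a positive direction: M is Metzler and Hurwitz, hence
    there are v > 0 and w > 0 with (A + B) v + E w < 0 and C v + D w < w
    ([positive_direction]).  Multiples of (v, w) are strict supersolutions, so that
    a subsolution stays below some K (v, w) ([subsystem_bounded]), and a bound
    s (v, w) valid at all late times improves to theta s (v, w) with a fixed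
    theta < 1 ([subsystem_contract]); the delayed arguments t - tau(t) are late
    when t is, so the delays do no harm.  Iterating gives the decay.

    The contraction step has to deal with the memory of the Caputo derivative:
    D^alpha x <= - a x + L holds for late times only, but D^alpha x depends on the
    whole past of x.  In [caputo_asymp_bound], x is compared with a barrier that is
    constant for a long time and then descends linearly, over a time span W, from
    an upper bound of x to a level L' > L / a.  The Caputo derivative of such a
    ramp is of order W^(- alpha), so for large W it is too small to let x touch
    the barrier.

    Touching is excluded by an extremum principle.  The solutions are merely
    continuous, so it cannot be read off from a pointwise formula; instead
    [kconv_extremum] shows that if w >= 0 on [0, t0] and w(t0) = 0, then the
    convolution of w with r^(- alpha) cannot grow at a linear rate up to t0.  Its
    increments over steps of length h are summed with weights taken from the
    discrete renewal equation of the sequence (n + 1)^(- alpha).  These weights are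
    nonnegative by a theorem of Kaluza, because the sequence is log-convex, and they
    cancel the kernel at distances larger than h ([kern_le_renewal]).  The weighted
    sum therefore only sees w on [t0 - h, t0], and is o(h^(1 - alpha)), while linear
    growth would make it at least of order h^(1 - alpha). *)

Set Implicit Arguments.
Unset Strict Implicit.

(** * Metzler matrices *)

Lemma finite_pos_lower_bound (R : realFieldType) (I : finType) (a : I -> R) : (forall i, 0 < a i) ->
  exists2 m, 0 < m & forall i, m <= a i.
Proof.
move=> a0; pose S := \sum_i (a i)^-1.
have S0 : 0 <= S by apply: sumr_ge0 => i _; rewrite invr_ge0 ltW.
exists (1 + S)^-1; first by rewrite invr_gt0 ltr_wpDr.
move=> i; rewrite -[leRHS]invrK lef_pV2 ?posrE ?invr_gt0 ?ltr_wpDr//.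
rewrite /S (bigD1 i)//= ler_wpDl// ler_wpDr//.
by apply: sumr_ge0 => j _; rewrite invr_ge0 ltW.
Qed.

Lemma ler_norm_sum_mem (R : realFieldType) (I : finType) (a : I -> R) i :
  `|a i| <= \sum_j `|a j|.
Proof. by rewrite (bigD1 i)//= lerDl sumr_ge0. Qed.

Lemma mulmx_nonneg (R : realFieldType) m p q (M : 'M[R]_(m, p)) (N : 'M[R]_(p, q)) :
  nonneg_mx M -> nonneg_mx N -> nonneg_mx (M *m N).
Proof. by move=> M0 N0 i j; rewrite mxE sumr_ge0// => k _; rewrite mulr_ge0. Qed.

Lemma mulmx_mono (R : realFieldType) m p (N : 'M[R]_(m, p)) (u v : 'cV[R]_p) i :
  nonneg_mx N -> (forall j, u j 0 <= v j 0) -> (N *m u) i 0 <= (N *m v) i 0.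
Proof. by move=> N0 uv; rewrite !mxE ler_sum// => j _; rewrite ler_wpM2l. Qed.

(** The diagonal entry of a Metzler matrix may be negative; its contribution is
    kept apart. *)
Lemma metzler_mono (R : realFieldType) m (A : 'M[R]_m) (u v : 'cV[R]_m) i :
  metzler A -> (forall j, u j 0 <= v j 0) ->
  (A *m u) i 0 <= (A *m v) i 0 + A i i * (u i 0 - v i 0).
Proof.
move=> mA uv; rewrite !mxE (bigD1 i)//= [X in _ <= X + _](bigD1 i)//= mulrBr.
have : \sum_(j < m | j != i) A i j * u j 0 <= \sum_(j < m | j != i) A i j * v j 0.
  by apply: ler_sum => j ji; rewrite ler_wpM2l// mA// eq_sym.
lra.
Qed.

(** A minimum principle: at an index where u_i / v_i is minimal and negative,
    row i of Q u is at most (u_i / v_i) (Q v)_i, which is negative. *)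
Lemma Zmx_monotone (R : realFieldType) m (Q : 'M[R]_m) (v : 'cV[R]_m) :
  (forall i j, i != j -> Q i j <= 0) -> (forall i, 0 < v i 0) ->
  (forall i, 0 < (Q *m v) i 0) ->
  forall u : 'cV[R]_m, (forall i, 0 <= (Q *m u) i 0) -> forall i, 0 <= u i 0.
Proof.
move=> Qoff v0 Qv0 u Qu0 i0.
case: (@arg_minP _ _ _ i0 xpredT (fun i => u i 0 / v i 0) isT) => i _ imin.
have [c0|c0] := leP 0 (u i 0 / v i 0).
  by have := le_trans c0 (imin i0 isT); rewrite ler_pdivlMr// mul0r.
have := Qu0 i; set c := u i 0 / v i 0 in imin c0.
suff : (Q *m u) i 0 <= c * (Q *m v) i 0.
  move=> h1 h2; have := le_trans h2 h1; rewrite leNgt.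
  by rewrite nmulr_rlt0 ?Qv0// .
rewrite !mxE mulr_sumr; apply: ler_sum => j _.
have [<-|ij] := eqVneq i j.
  by rewrite mulrCA /c divfK// gt_eqF.
rewrite mulrCA ler_wnM2l ?Qoff//.
by have := imin j isT; rewrite ler_pdivlMr.
Qed.

Lemma Zmx_unit (R : realFieldType) m (Q : 'M[R]_m) (v : 'cV[R]_m) :
  (forall i j, i != j -> Q i j <= 0) -> (forall i, 0 < v i 0) ->
  (forall i, 0 < (Q *m v) i 0) -> Q \in unitmx.
Proof.
move=> Qoff v0 Qv0; rewrite -unitmx_tr unitmxE unitfE; apply/negP => /det0P[u un0 uQ].
move/negP: un0; apply; apply/eqP/trmx_inj.
have Qu : Q *m u^T = 0 by rewrite -[Q]trmxK -trmx_mul uQ trmx0.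
have h1 := @Zmx_monotone _ _ Q v Qoff v0 Qv0 u^T.
have h2 := @Zmx_monotone _ _ Q v Qoff v0 Qv0 (- u^T).
have Qu0 k : 0 <= (Q *m u^T) k 0 by rewrite Qu mxE.
have Qu0' k : 0 <= (Q *m - u^T) k 0 by rewrite mulmxN Qu oppr0 mxE.
apply/matrixP => i j; rewrite trmx0 (ord1 j) [RHS]mxE.
apply/eqP; rewrite eq_le h1// andbT.
by have := h2 Qu0' i; rewrite [X in 0 <= X]mxE oppr_ge0.
Qed.

Lemma hurwitz_unit (R : rcfType) m (M : 'M[R]_m) (s : R) : hurwitz M -> 0 <= s ->
  (s%:M - M) \in unitmx.
Proof.
move=> hM s0; rewrite unitmxE unitfE; apply/negP => /det0P[u un0].
rewrite mulmxBr mul_mx_scalar => /eqP; rewrite subr_eq0 eq_sym => /eqP uM.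
have : eigenvalue (map_mx (real_complex R) M) (real_complex R s).
  apply/eigenvalueP; exists (map_mx (real_complex R) u).
    by rewrite -map_mxM uM map_mxZ.
  by rewrite map_mx_eq0.
by move/hM => /=; rewrite ltNge s0.
Qed.

(** The set S of the s >= 0 for which s - M maps some positive vector to a
    positive one contains all large s.  At its infimum s0 the matrix s0 - M is
    still invertible, and v = (s0 - M)^-1 1 is nonnegative because (s - M) v > 0
    for the elements s of S close to s0.  Hence s0 belongs to S; the same v
    shows that S would contain points to the left of s0 if s0 were positive. *)
Lemma metzler_hurwitz_pos (R : realType) m (M : 'M[R]_m) : metzler M -> hurwitz M ->
  exists2 v : 'cV[R]_m, (forall i, 0 < v i 0) & (forall i, (M *m v) i 0 < 0).
Proof.
move=> Mm Mh.
pose S := [set s : R | 0 <= s /\ exists2 v : 'cV[R]_m, (forall i, 0 < v i 0) &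
   (forall i, 0 < ((s%:M - M) *m v) i 0)].
have Moff s i j : i != j -> (s%:M - M) i j <= 0.
  by move=> ij; rewrite !mxE (negPf ij) mulr0n sub0r oppr_le0 Mm.
have hS : has_inf S.
  split; last by exists 0 => s [].
  exists (1 + \sum_i \sum_j `|M i j|); split.
    by rewrite addr_ge0// sumr_ge0// => i _; rewrite sumr_ge0.
  exists (const_mx 1); first by move=> i; rewrite mxE.
  move=> i; rewrite mulmxBl mul_scalar_mx !mxE mulr1 subr_gt0.
  apply: (@le_lt_trans _ _ (\sum_i \sum_j `|M i j|)); last by rewrite ltrDr.
  rewrite [leRHS](bigD1 i)//= ler_wpDr//; first by rewrite sumr_ge0// => k _; rewrite sumr_ge0.
  by apply: ler_sum => j _; rewrite mxE mulr1 ler_norm.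
set s0 := inf S.
have s00 : 0 <= s0 by apply: lb_le_inf; [exact: hS.1|move=> s []].
have uS := hurwitz_unit Mh s00.
pose v : 'cV[R]_m := invmx (s0%:M - M) *m const_mx 1.
have vE : (s0%:M - M) *m v = const_mx 1 by rewrite /v mulKVmx.
pose N := 1 + \sum_j `|v j 0|.
have N0 : 0 < N by rewrite ltr_wpDr// sumr_ge0.
have vN i : `|v i 0| <= N.
  by apply: (le_trans (ler_norm_sum_mem (fun i => v i 0) i)); rewrite lerDr.
have shift h i : (((s0 + h)%:M - M) *m v) i 0 = 1 + h * v i 0.
  rewrite raddfD/= addrAC mulmxDl vE mul_scalar_mx !mxE; ring.
have v0 i : 0 <= v i 0.
  have iN : 0 < N^-1 by rewrite invr_gt0.
  have [s [sp [v' v'0 v'S]] st] := inf_adherent iN hS.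
  have ss : s0 <= s by apply: ge_inf; [exact: hS.2|split=> //; exists v'].
  apply: (Zmx_monotone (Moff s) v'0 v'S) => k.
  rewrite -(subrKC s0 s) shift.
  have : `|(s - s0) * v k 0| <= 1.
    rewrite normrM ger0_norm ?subr_ge0//.
    apply: (@le_trans _ _ (N^-1 * N)); last by rewrite mulVf// gt_eqF.
    by apply: ler_pM; rewrite ?subr_ge0// lerBlDl ltW.
  by rewrite ler_norml => /andP[h _]; lra.
have vp i : 0 < v i 0.
  rewrite lt_neqAle v0 andbT; apply/eqP => e.
  have : ((s0%:M - M) *m v) i 0 <= 0.
    rewrite mxE sumr_le0// => j _; have [<-|ij] := eqVneq i j; first by rewrite -e mulr0.
    by rewrite mulr_le0_ge0// Moff.
  by rewrite vE mxE ler10.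
have s0E : s0 = 0.
  apply/eqP; rewrite eq_le s00 andbT leNgt; apply/negP => sp.
  pose h := Num.min s0 (N^-1 / 2).
  have h0 : 0 < h by rewrite lt_min sp divr_gt0// invr_gt0.
  have hs : h <= s0 by rewrite ge_min lexx.
  have hN : h <= N^-1 / 2 by rewrite ge_min lexx orbT.
  have : S (s0 - h).
    split; first by rewrite subr_ge0.
    exists v => // i; rewrite shift mulNr subr_gt0.
    apply: (@le_lt_trans _ _ (N^-1 / 2 * N)); last first.
      by rewrite mulrAC mulVf ?gt_eqF//; lra.
    apply: ler_pM => //; first exact: ltW.
    by apply: le_trans (vN i); exact: ler_norm.
  move/(ge_inf hS.2); rewrite -/s0; lra.
exists v => // i.
have : (- M *m v) i 0 = 1.
  by move: vE; rewrite s0E raddf0 sub0r => ->; rewrite mxE.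
rewrite mulNmx mxE => h; lra.
Qed.

Lemma invmx_1B_nonneg (R : realType) n (D : 'M[R]_n) : nonneg_mx D ->
  (forall i, \sum_j `|D i j| < 1) ->
  (1%:M - D) \in unitmx /\ nonneg_mx (invmx (1%:M - D)).
Proof.
move=> D0 D1.
have off i j : i != j -> (1%:M - D) i j <= 0.
  by move=> ij; rewrite !mxE (negPf ij) mulr0n sub0r oppr_le0.
have v0 i : 0 < (const_mx 1 : 'cV[R]_n) i 0 by rewrite mxE.
have Qv i : 0 < ((1%:M - D) *m (const_mx 1 : 'cV[R]_n)) i 0.
  rewrite mulmxBl mul1mx !mxE subr_gt0; apply: le_lt_trans (D1 i).
  by apply: ler_sum => j _; rewrite mxE mulr1 ler_norm.
have U := Zmx_unit off v0 Qv; split=> // i j.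
have -> : invmx (1%:M - D) i j = (col j (invmx (1%:M - D))) i 0 by rewrite mxE.
apply: (Zmx_monotone off v0 Qv) => k.
by rewrite colE mulmxA mulmxV// mul1mx !mxE andbT; case: eqVneq.
Qed.

(** Take v with M v < 0 and w = (I - D)^-1 (C v + eps 1) with a small eps. *)
Lemma positive_direction (R : realType) d n (A B : 'M[R]_d) (E : 'M[R]_(d, n))
    (C : 'M[R]_(n, d)) (D : 'M[R]_n) :
  metzler A -> nonneg_mx B -> nonneg_mx C -> nonneg_mx D -> nonneg_mx E ->
  hurwitz (A + B + E *m invmx (1%:M - D) *m C) ->
  (forall i, \sum_j `|D i j| < 1) ->
  exists v : 'cV[R]_d, exists w : 'cV[R]_n,
   [/\ forall i, 0 < v i 0, forall i, 0 < w i 0,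
       forall i, (A *m v + B *m v + E *m w) i 0 < 0 &
       forall i, (C *m v + D *m w) i 0 < w i 0].
Proof.
move=> mA B0 C0 D0 E0 hM D1.
have [U H0] := invmx_1B_nonneg D0 D1.
set H := invmx (1%:M - D) in hM U H0 *.
have mM : metzler (A + B + E *m H *m C).
  move=> i j ij; rewrite !mxE !addr_ge0 ?mA//.
  by have := mulmx_nonneg (mulmx_nonneg E0 H0) C0 i j; rewrite mxE.
have [v v0 Mv] := metzler_hurwitz_pos mM hM.
have Mv' i : 0 < - ((A + B + E *m H *m C) *m v) i 0 by rewrite oppr_gt0.
have [mu mu0 muM] := finite_pos_lower_bound Mv'.
pose one : 'cV[R]_n := const_mx 1.
have one0 : nonneg_mx one by move=> i j; rewrite mxE.
have EH0 := mulmx_nonneg (mulmx_nonneg E0 H0) one0.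
pose N := 1 + \sum_i `|(E *m H *m one) i 0|.
have N0 : 0 < N by rewrite ltr_wpDr// sumr_ge0.
pose eps := mu / N.
have eps0 : 0 < eps by rewrite divr_gt0.
have epsM i : eps * (E *m H *m one) i 0 < mu.
  apply: (@lt_le_trans _ _ (eps * N)); last by rewrite /eps divfK// gt_eqF.
  rewrite ltr_pM2l// /N; apply: le_lt_trans (ler_norm _) _.
  apply: le_lt_trans (ler_norm_sum_mem (fun i => (E *m H *m one) i 0) i) _.
  by rewrite ltrDr.
have v0' : nonneg_mx v by move=> i j; rewrite (ord1 j) ltW.
pose w := H *m (C *m v + eps *: one).
have wE : w = C *m v + D *m w + eps *: one.
  have : (1%:M - D) *m w = C *m v + eps *: one by rewrite /w mulKVmx.
  rewrite mulmxBl mul1mx => /eqP; rewrite subr_eq => /eqP {1}->.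
  by rewrite addrAC.
have w0' : nonneg_mx w.
  apply: mulmx_nonneg => // i j; rewrite mxE addr_ge0//; first exact: mulmx_nonneg.
  by rewrite !mxE mulr1 ltW.
exists v, w; split => // i.
- rewrite wE mxE [X in X + _]mxE ltr_wpDl//; last by rewrite !mxE mulr1.
  by rewrite addr_ge0// mulmx_nonneg.
- have -> : A *m v + B *m v + E *m w =
     (A + B + E *m H *m C) *m v + eps *: (E *m H *m one).
    rewrite /w !mulmxDl mulmxDr mulmxDr -!mulmxA !scalemxAr.
    by rewrite !addrA.
  rewrite mxE [X in _ + X]mxE; have := epsM i; have := muM i; lra.
- rewrite [in X in _ < X]wE [X in _ < X]mxE ltrDl !mxE mulr1//.
Qed.

(** * The discrete renewal equation *)

(** Course-of-values recursion through the list of the first n terms. *)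
Fixpoint renewal_seq (R : realType) (c : nat -> R) (n : nat) : seq R :=
  if n is m.+1 then
    let s := renewal_seq c m in
    rcons s (c m.+1 - \sum_(j < m) s`_j * c (m - j)%N)
  else [::].

(** The solution a of the renewal equation c(n + 1) = a(0) c(n) + ... + a(n) c(0),
    see [renewalE]. *)
Definition renewal (R : realType) (c : nat -> R) (n : nat) : R :=
  (renewal_seq c n.+1)`_n.

Lemma size_renewal_seq (R : realType) (c : nat -> R) n : size (renewal_seq c n) = n.
Proof. by elim: n => //= n IH; rewrite size_rcons IH. Qed.

Lemma nth_renewal_seq (R : realType) (c : nat -> R) n j : (j < n)%N ->
  (renewal_seq c n)`_j = renewal c j.
Proof.
elim: n => // n IH; rewrite ltnS leq_eqVlt => /predU1P[-> //|jn].
by rewrite /= nth_rcons size_renewal_seq jn IH.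
Qed.

Lemma renewalE (R : realType) (c : nat -> R) n : c 0%N = 1 ->
  c n.+1 = \sum_(j < n.+1) renewal c j * c (n - j)%N.
Proof.
move=> c0; rewrite big_ord_recr/= subnn c0 mulr1 /renewal/=.
rewrite nth_rcons size_renewal_seq ltnn eqxx.
rewrite addrC -addrA [X in _ + X](_ : _ = 0) ?addr0//.
rewrite addrC; apply/eqP; rewrite subr_eq0; apply/eqP.
by apply: eq_bigr => j _; rewrite nth_renewal_seq.
Qed.

Definition renewal_tail (R : realType) (al : nat -> R) (j : nat) : R := 1 - \sum_(i < j) al i.

Lemma renewal_tailS (R : realType) (al : nat -> R) n : renewal_tail al n.+1 = renewal_tail al n - al n.
Proof. by rewrite /renewal_tail big_ord_recr/= opprD addrA. Qed.

(** Kaluza's theorem.  By induction, the terms a(0), ..., a(n) are nonnegative.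
    Multiplying the renewal equation of c(n + 1) by c(n + 2) / c(n + 1) replaces
    each c(n - j) by at least c(n + 1 - j), because the ratios of successive terms
    of c increase; so the part of c(n + 2) that is due to a(0), ..., a(n) does not
    exceed c(n + 2). *)
Lemma kaluza (R : realType) (c : nat -> R) : c 0%N = 1 -> (forall n, 0 < c n) ->
  (forall m n, (m <= n)%N -> c m.+1 * c n <= c n.+1 * c m) ->
  forall n, 0 <= renewal c n.
Proof.
move=> c0 cp lc n; have [k] := ubnP n; elim: k n => // k IH [_|n nk].
  have := renewalE 0 c0; rewrite big_ord1 subnn c0 mulr1 => <-.
  exact: ltW.
have := renewalE n.+1 c0; rewrite big_ord_recr/= subnn c0 mulr1 => E.
suff : \sum_(j < n.+1) renewal c j * c (n.+1 - j)%N <= c n.+2 by rewrite E; lra.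
rewrite -(ler_pM2l (cp n.+1)) [leRHS]mulrC {2}(renewalE n c0) !mulr_sumr.
apply: ler_sum => j _; have jn : (j <= n)%N by rewrite -ltnS.
rewrite mulrCA [leRHS]mulrCA ler_wpM2l//.
  by apply: IH; rewrite -ltnS (leq_trans _ nk)// !ltnS.
rewrite mulrC (subSn jn); apply: lc; exact: leq_trans (leq_subr _ _) _.
Qed.

(** As c decreases, c(n) (a(0) + ... + a(n)) <= c(n + 1) <= c(n). *)
Lemma renewal_tail_ge0 (R : realType) (c : nat -> R) : c 0%N = 1 -> (forall n, 0 < c n) ->
  (forall m n, (m <= n)%N -> c n <= c m) -> (forall n, 0 <= renewal c n) ->
  forall n, 0 <= renewal_tail (renewal c) n.
Proof.
move=> c0 cp cd r0 [|n]; first by rewrite /renewal_tail big_ord0 subr0.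
rewrite subr_ge0 -(ler_pM2l (cp n)) mulr1.
rewrite (le_trans _ (cd n n.+1 _))// renewalE// mulr_sumr.
apply: ler_sum => j _; rewrite mulrC ler_wpM2l//.
by apply: cd; exact: leq_subr.
Qed.

(** In terms of generating functions, c(z) = 1 / (1 - z a(z)) and the tails of a
    have the series (1 - z a(z)) / (1 - z); the product is 1 / (1 - z). *)
Lemma renewal_tail_conv (R : realType) (c : nat -> R) n : c 0%N = 1 ->
  \sum_(j < n.+1) renewal_tail (renewal c) j * c (n - j)%N = 1.
Proof.
move=> c0; elim: n => [|n IH].
  by rewrite big_ord1 c0 /renewal_tail big_ord0 subr0 mulr1.
rewrite big_ord_recl /= {1}/renewal_tail big_ord0 subr0 mul1r subn0.
under eq_bigr => j _ do rewrite /bump/= add1n subSS renewal_tailS mulrBl.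
by rewrite sumrB IH -renewalE//; lra.
Qed.

Lemma sum_conv (R : realType) (b c : nat -> R) n :
  \sum_(m < n) \sum_(j < m.+1) b j * c (m - j)%N =
  \sum_(j < n) b j * \sum_(i < (n - j)%N) c i.
Proof.
elim: n => [|n IH]; first by rewrite !big_ord0.
rewrite big_ord_recr/= IH [RHS]big_ord_recr/= [in LHS]big_ord_recr/=.
rewrite subSn// subnn big_ord1 addrA; congr (_ + _).
rewrite -big_split/=; apply: eq_bigr => j _.
by rewrite subSn 1?ltnW// big_ord_recr/= mulrDr.
Qed.

Lemma ler_sum_ord (R : realType) (F : nat -> R) k l : (forall i, 0 <= F i) ->
  (k <= l)%N -> \sum_(i < k) F i <= \sum_(i < l) F i.
Proof.
move=> F0 kl; rewrite -(subnKC kl) big_split_ord/= lerDl.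
by apply: sumr_ge0 => i _.
Qed.

(** Summing [renewal_tail_conv] over the first n indices. *)
Lemma renewal_tail_sum_ge (R : realType) (c : nat -> R) n : c 0%N = 1 -> (forall n, 0 < c n) ->
  (forall n, 0 <= renewal_tail (renewal c) n) ->
  n%:R <= (\sum_(j < n) renewal_tail (renewal c) j) * \sum_(i < n) c i.
Proof.
move=> c0 cp r0.
have -> : n%:R = \sum_(m < n) \sum_(j < m.+1) renewal_tail (renewal c) j * c (m - j)%N.
  under eq_bigr => m _ do rewrite renewal_tail_conv//.
  by rewrite sumr_const card_ord.
rewrite sum_conv mulr_suml; apply: ler_sum => j _; rewrite ler_wpM2l//.
by apply: ler_sum_ord => [i|]; [exact: ltW|exact: leq_subr].
Qed.

Lemma abel_summation (R : realType) (al J : nat -> R) (M : nat) :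
  \sum_(j < M.+1) renewal_tail al j * (J j - J j.+1) =
  J 0%N - \sum_(j < M) al j * J j.+1 - renewal_tail al M * J M.+1.
Proof.
elim: M => [|M IH].
  by rewrite big_ord1 big_ord0 /renewal_tail big_ord0; lra.
by rewrite big_ord_recr/= IH big_ord_recr/= renewal_tailS; lra.
Qed.

Lemma powR_antitone (R : realType) (b x y : R) : b <= 1 -> 0 < x -> x <= y ->
  y `^ (b - 1) <= x `^ (b - 1).
Proof.
move=> b1 x0 xy; have y0 := lt_le_trans x0 xy.
rewrite -(opprB 1 b) !powRN lef_pV2 ?posrE ?powR_gt0//.
by rewrite ge0_ler_powR ?nnegrE ?subr_ge0// ltW.
Qed.

(** The values of the kernel r^(b - 1) at the positive integers; b stands for
    1 - alpha. *)
Definition pow_seq (R : realType) (b : R) (n : nat) : R := n.+1%:R `^ (b - 1).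

Lemma pow_seq0 (R : realType) (b : R) : pow_seq b 0 = 1.
Proof. by rewrite /pow_seq powR1. Qed.

Lemma pow_seq_gt0 (R : realType) (b : R) n : 0 < pow_seq b n.
Proof. by rewrite powR_gt0. Qed.

Lemma pow_seq_antitone (R : realType) (b : R) m n : b <= 1 -> (m <= n)%N -> pow_seq b n <= pow_seq b m.
Proof. by move=> b1 mn; apply: powR_antitone => //; rewrite ler_nat. Qed.

Lemma pow_seq_logconvex (R : realType) (b : R) m n : b <= 1 -> (m <= n)%N ->
  pow_seq b m.+1 * pow_seq b n <= pow_seq b n.+1 * pow_seq b m.
Proof.
move=> b1 mn; rewrite /pow_seq -!powRM//; apply: powR_antitone => //.
by rewrite -!natrM ler_nat; nia.
Qed.

(** Bernoulli's inequality up to the factor 1 / 2, from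
    (1 - y)^b <= exp (- b y) <= 1 / (1 + b y). *)
Lemma powR_1B_le (R : realType) (b y : R) : 0 < b -> b < 1 -> 0 <= y <= 1 ->
  (1 - y) `^ b <= 1 - b * y / 2.
Proof.
move=> b0 b1 /andP[y0]; rewrite le_eqVlt => /predU1P[->|y1].
  by rewrite subrr powR0 ?gt_eqF//; lra.
have y1' : 0 < 1 - y by rewrite subr_gt0.
rewrite /powR gt_eqF//.
have by0 : 0 <= b * y by rewrite mulr_ge0// ltW.
have by1 : b * y <= 1 by rewrite mulr_ile1// ltW.
have h1 : b * ln (1 - y) <= - (b * y).
  by rewrite -mulrN ler_pM2l// le_ln1Dx// ltrN2.
apply: (@le_trans _ _ (expR (- (b * y)))); first by rewrite ler_expR.
rewrite expRN; apply: (@le_trans _ _ (1 + b * y)^-1).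
  by rewrite lef_pV2 ?posrE ?expR_gt0 ?expR_ge1Dx//; lra.
rewrite -div1r ler_pdivrMr; last lra.
have : 0 <= b * y * (1 - b * y) by rewrite mulr_ge0// subr_ge0.
lra.
Qed.

Lemma sum_pow_seq_le (R : realType) (b : R) n : 0 < b -> b < 1 ->
  \sum_(i < n) pow_seq b i <= 2 / b * n%:R `^ b.
Proof.
move=> b0 b1; elim: n => [|n IH].
  by rewrite big_ord0 mulr_ge0 ?powR_ge0// divr_ge0// ltW.
rewrite big_ord_recr/=.
suff : pow_seq b n <= 2 / b * (n.+1%:R `^ b - n%:R `^ b) by lra.
have x0 : 0 < n.+1%:R :> R by [].
have -> : n%:R `^ b = n.+1%:R `^ b * (1 - n.+1%:R^-1) `^ b :> R.
  rewrite -powRM//.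
    by congr (_ `^ _); rewrite mulrBr mulr1 divff// -(natrB _ (ltn0Sn n)) subn1.
  by rewrite subr_ge0 invf_le1// ler1n.
have yb : 0 <= (n.+1%:R^-1 : R) <= 1 by rewrite invr_ge0 ler0n/= invf_le1// ler1n.
have := powR_1B_le b0 b1 yb.
have -> : n.+1%:R `^ b = pow_seq b n * n.+1%:R :> R.
  by rewrite /pow_seq mulrC mulr_powRB1.
set q := _ `^ b => hq.
have p0 := pow_seq_gt0 b n; set p := pow_seq b n in p0 *; set x := n.+1%:R : R in x0 hq *.
have : 2 / b * (p * x) * (b * x^-1 / 2) <= 2 / b * (p * x) * (1 - q).
  rewrite ler_wpM2l//; last by rewrite lerBrDr addrC -lerBrDr.
  by rewrite mulr_ge0 ?divr_ge0 ?mulr_ge0// ltW.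
have -> : 2 / b * (p * x) * (b * x^-1 / 2) = p by field; rewrite !gt_eqF.
lra.
Qed.

(** The tails sum to a multiple of n^(1 - b): with a slower growth the increments
    in the extremum principle would be too small to detect. *)
Lemma renewal_tail_pow_seq_ge (R : realType) (b : R) n : 0 < b -> b < 1 -> 
  (forall n, 0 <= renewal_tail (renewal (pow_seq b)) n) -> (0 < n)%N ->
  b / 2 * n%:R / n%:R `^ b <= \sum_(j < n) renewal_tail (renewal (pow_seq b)) j.
Proof.
move=> b0 b1 r0 n0.
have nb : 0 < n%:R `^ b :> R by rewrite powR_gt0// ltr0n.
rewrite ler_pdivrMr//.
have h := @renewal_tail_sum_ge _ (pow_seq b) n (pow_seq0 b) (pow_seq_gt0 b) r0.
have h2 : n%:R <= (\sum_(j < n) renewal_tail (renewal (pow_seq b)) j) * (2 / b * n%:R `^ b).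
  by apply: (le_trans h); rewrite ler_wpM2l ?sum_pow_seq_le// sumr_ge0.
have : b / 2 * n%:R <= b / 2 * ((\sum_(j < n) renewal_tail (renewal (pow_seq b)) j) * (2 / b * n%:R `^ b)).
  by rewrite ler_pM2l// divr_gt0.
move/le_trans; apply; rewrite le_eqVlt; apply/orP; left; apply/eqP; field.
by rewrite gt_eqF.
Qed.

(** * Convolution with the power kernel *)

Lemma powR_continuous_pt (R : realType) (p x : R) : 0 < x ->
  {for x, continuous (fun y : R => y `^ p)}.
Proof.
move=> x0; apply: differentiable_continuous; apply/derivable1_diffP.
by apply: derivable_powR; rewrite in_itv/= x0.
Qed.

Lemma integral_powR_trunc (R : realType) (p a b t : R) : 0 < p -> a < b -> b < t ->
  (\int[@lebesgue_measure R]_(s in `[a, b]) ((t - s) `^ (p - 1))%:E =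
    ((t - a) `^ p / p - (t - b) `^ p / p)%:E)%E.
Proof.
move=> p0 ab bt.
pose F s : R := - (t - s) `^ p / p.
have dF s : s < t -> is_derive s 1 F ((t - s) `^ (p - 1)).
  move=> st; have ts : 0 < t - s by rewrite subr_gt0.
  have d1 : is_derive s 1 (fun s => t - s) (-1).
    by apply: is_derive_eq; rewrite add0r mul1r.
  have := @is_derive1_comp _ _ (fun s => t - s) s _ _ (is_derive1_powR p ts) d1.
  move=> d2; rewrite /F.
  have -> : (fun s : R => - (t - s) `^ p / p) = (- p^-1) \*: ((fun y : R => y `^ p) \o (fun s => t - s)).
    by apply/funext => y /=; rewrite /GRing.scale/=; field; rewrite gt_eqF.
  apply: is_derive_eq.
  by rewrite /GRing.scale/=; field; rewrite gt_eqF.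
rewrite (@continuous_FTC2 _ _ F)//.
- by rewrite /F -EFinB; congr EFin; lra.
- apply: continuous_in_subspaceT => s /[!inE]/=; rewrite in_itv/= => /andP[_ sb].
  have ts : 0 < t - s by rewrite subr_gt0 (le_lt_trans sb).
  have h : t - x @[x --> s] --> t - s by apply: cvgB; [exact: cvg_cst|exact: cvg_id].
  rewrite /continuous_at /=. have h2 := (@cvg_comp _ _ _ (fun x => t - x) _ _ _ _ h (@powR_continuous_pt _ (p-1) _ ts)). exact: h2.
- have cF s : s < t -> {for s, continuous F}.
    move=> st; apply: differentiable_continuous; apply/derivable1_diffP.
    by have [] := dF _ st.
  split.
  + by move=> s /[!in_itv]/= /andP[_ sb]; have [] := dF s (lt_trans sb bt).
  + by apply: cvg_at_right_filter; apply: cF; exact: lt_trans bt.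
  + by apply: cvg_at_left_filter; apply: cF.
- move=> s /[!in_itv]/= /andP[_ sb].
  by rewrite derive1E; have [_ ->] := dF s (lt_trans sb bt).
Qed.

Lemma measurable_powR_sub (R : realType) (g t : R) (D : set R) :
  measurable_fun D (fun s : R => (t - s) `^ g).
Proof.
apply: measurable_funTS.
apply: (measurableT_comp (measurable_powR g)).
by apply: measurable_funB.
Qed.

(** The integrand is unbounded at t when p < 1; the integral is the limit of
    integrals over [a, b n] with b n increasing to t. *)
Lemma integral_powR (R : realType) (p a t : R) : 0 < p -> a <= t ->
  (\int[@lebesgue_measure R]_(s in `[a, t]) ((t - s) `^ (p - 1))%:E =
    ((t - a) `^ p / p)%:E)%E.
Proof.
move=> p0; rewrite le_eqVlt => /predU1P[->|at_].
  by rewrite set_itv1 integral_set1 subrr powR0 ?gt_eqF// mul0r.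
rewrite -integral_itv_bndo_bndc; last by apply/measurable_EFinP; apply: measurable_powR_sub.
pose b n : R := t - (t - a) / n.+2%:R.
have ta : 0 < t - a by rewrite subr_gt0.
have bt n : b n < t by rewrite /b ltrBlDr ltrDl divr_gt0.
have ab n : a < b n.
  rewrite /b ltrBrDr -ltrBrDl ltr_pdivrMr// ltr_pMr//.
  by rewrite (ltr_nat _ 1).
have b_nd n m : (n <= m)%N -> b n <= b m.
  by move=> nm; rewrite /b lerD2l lerN2 ler_pM2l// lef_pV2 ?posrE// ler_nat ltnS.
have U : `[a, t[%classic = \bigcup_n `[a, b n]%classic.
  apply/seteqP; split=> s /=; rewrite in_itv/=.
    case/andP=> as_ st.
    have /ltr_add_invr [k kP] : t - s > 0 by rewrite subr_gt0.
    have : exists n : nat, (t - a) / (t - s) < n%:R.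
      by eexists; apply: archi_boundP; rewrite divr_ge0// ltW// subr_gt0.
    move=> [n hn]; exists n => //=; rewrite in_itv/= as_/= /b lerBrDr -lerBrDl.
    rewrite ler_pdivrMr// mulrC -ler_pdivrMr ?subr_gt0//.
    by rewrite (le_trans (ltW hn))// ler_nat leqW// leqnSn.
  by move=> [n _]; rewrite /= !in_itv/= => /andP[-> h]; exact: le_lt_trans (bt n).
rewrite U.
have c1 := @ge0_nondecreasing_set_cvg_integral _ (measurableTypeR R) R
   (fun n => `[a, b n]%classic) (fun s => ((t - s) `^ (p - 1))%:E) (@lebesgue_measure R).
have {c1}c1 : (\int[@lebesgue_measure R]_(s in `[a, b n]) ((t - s) `^ (p - 1))%:E)%E @[n --> \oo] -->
   (\int[@lebesgue_measure R]_(s in \bigcup_n `[a, b n]%classic) ((t - s) `^ (p - 1))%:E)%E.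
  apply: c1.
  - by move=> n m nm; apply/subsetPset/subset_itvl; rewrite bnd_simp b_nd.
  - by [].
  - by move=> i; by apply/measurable_EFinP; apply: measurable_powR_sub.
  - by move=> i x _; rewrite lee_fin powR_ge0.
apply: (cvg_unique _ c1) => //.
rewrite (_ : (fun n => _) = (fun n => ((t - a) `^ p / p - (t - b n) `^ p / p)%:E)); last first.
  by apply/funext => n; exact: integral_powR_trunc.
apply: cvg_EFin; first by apply: nearW.
rewrite /=.
have -> : (fine \o (fun n => ((t - a) `^ p / p - (t - b n) `^ p / p)%:E)) =
  (fun n => (t - a) `^ p / p - (t - b n) `^ p / p) by [].
rewrite -[X in _ --> X]subr0; apply: cvgB; first exact: cvg_cst.
rewrite -(mul0r p^-1); apply: cvgM; last exact: cvg_cst.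
have c0 : t - b n @[n --> \oo] --> (0 : R).
  rewrite /b; under eq_fun do rewrite opprB addrC subrK.
  rewrite -(mulr0 (t - a)); apply: cvgM; first exact: cvg_cst.
  by have := @cvg_harmonic R; rewrite -(@cvg_shiftS).
have : (t - b n) `^ p @[n --> \oo] --> (0 : R).
  apply: (@cvg_comp _ _ _ (fun n => t - b n) (fun y : R => y `^ p) _ (0^'+)).
    move=> A /= /nbhs_ballP[e e0 eA].
    have /cvgrPdist_lt /(_ _ e0) := c0; apply: filterS => n h.
    by apply: eA => //=; rewrite subr_gt0.
  exact: powR_cvg0.
by [].
Qed.

(** The kernel r^(b - 1), cut off at r <= 0 so that convolutions up to different
    times are integrals over one and the same interval ([kconv_widen]). *)
Definition kern (R : realType) (b r : R) : R := if 0 < r then r `^ (b - 1) else 0.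

Definition kconv (R : realType) (b : R) (u : R -> R) (t : R) : R :=
  \int[@lebesgue_measure R]_(s in `[0, t]) (kern b (t - s) * u s).

Lemma kern_ge0 (R : realType) (b r : R) : 0 <= kern b r.
Proof. by rewrite /kern; case: ifP => // _; exact: powR_ge0. Qed.

Lemma kern_antitone (R : realType) (b r r' : R) : b <= 1 -> 0 < r -> r <= r' ->
  kern b r' <= kern b r.
Proof.
move=> b1 r0 rr'; have r'0 := lt_le_trans r0 rr'.
by rewrite /kern r0 r'0; exact: powR_antitone.
Qed.

Lemma kernE (R : realType) (b t s : R) : b < 1 -> s <= t ->
  kern b (t - s) = (t - s) `^ (b - 1).
Proof.
move=> b1; rewrite le_eqVlt => /predU1P[->|st]; last by rewrite /kern subr_gt0 st.
by rewrite /kern subrr ltxx powR0// subr_eq0 lt_eqF.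
Qed.

Lemma measurable_kern (R : realType) (b t : R) (D : set R) :
  measurable_fun D (fun s : R => kern b (t - s)).
Proof.
apply: measurable_funTS; apply: measurable_fun_ifT => //.
  by apply: measurable_fun_ltr => //; apply: measurable_funB.
exact: measurable_powR_sub.
Qed.

Lemma integrable_kern (R : realType) (b a T t : R) : 0 < b -> b < 1 ->
  (@lebesgue_measure R).-integrable `[a, T] (EFin \o (fun s => kern b (t - s))).
Proof.
move=> b0 b1.
have [ta|at_] := ltP t a.
  apply: (eq_integrable _ (cst 0%E)) => //; last exact: integrable0.
  move=> s; rewrite inE/= in_itv/= => /andP[as_ _].
  by rewrite /kern subr_gt0 ltNge (le_trans (ltW ta) as_).
have sub : `[a, T]%classic `<=` `[a, Num.max t T]%classic.
  by apply: subset_itvl; rewrite bnd_simp le_max lexx orbT.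
apply: (@integrableS _ (measurableTypeR R) R (@lebesgue_measure R) _ _ _ _ _ sub) => //.
have E : EFin \o (fun s => kern b (t - s)) =
   (EFin \o (fun s => kern b (t - s))) \_ [set s | s <= t].
  apply/funext => s; rewrite patchE; case: ifPn => //.
  by rewrite notin_setE /= => /negP; rewrite -ltNge /kern subr_gt0 => /lt_gtF ->.
rewrite E; apply/integrable_restrict => //.
  by rewrite -set_itvNyc; exact: measurable_itv.
rewrite (_ : _ `&` _ = `[a, t]%classic); last first.
  apply/seteqP; split => s /=; rewrite !in_itv/= ?le_max.
    by move=> []; do ? [move=> /andP[-> _]|move=> ->].
  by move=> /andP[-> ->].
apply/integrableP; split; first by apply/measurable_EFinP; exact: measurable_kern.
under eq_integral => s.
  rewrite inE/= in_itv/= => /andP[_ st].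
  rewrite kernE// ger0_norm ?powR_ge0//.
  over.
by rewrite integral_powR// ltry.
Qed.

Lemma continuous_bounded_segment (R : realType) (u : R -> R) (a T : R) : continuous u ->
  [bounded u x | x in `[a, T]%classic].
Proof.
move=> cu.
have /compact_bounded[M [_ mrt]] :=
  continuous_compact (continuous_subspaceT cu) (@segment_compact _ a T).
by exists M; split; rewrite ?num_real // => ? ? ? ?; exact: mrt.
Qed.

Lemma integrable_kernM (R : realType) (b a T t : R) (u : R -> R) : 0 < b -> b < 1 ->
  continuous u ->
  (@lebesgue_measure R).-integrable `[a, T] (EFin \o (fun s => kern b (t - s) * u s)).
Proof.
move=> b0 b1 cu.
have := @integrableMl _ _ _ (@lebesgue_measure R) `[a, T]%classic _ _ u (integrable_kern a T t b0 b1).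
apply => //.
  by apply: measurable_funTS; exact: continuous_measurable_fun.
exact: continuous_bounded_segment.
Qed.

Lemma integral_kern (R : realType) (b a t : R) : 0 < b -> b < 1 -> a <= t ->
  \int[@lebesgue_measure R]_(s in `[a, t]) kern b (t - s) = (t - a) `^ b / b.
Proof.
move=> b0 b1 at_; rewrite /Rintegral -[RHS]/(fine ((t - a) `^ b / b)%:E).
rewrite -integral_powR//; congr fine; apply: eq_integral => s.
by rewrite inE/= in_itv/= => /andP[_ st]; rewrite kernE.
Qed.

Lemma kconv_widen (R : realType) (b t T : R) (u : R -> R) : t <= T ->
  kconv b u t = \int[@lebesgue_measure R]_(s in `[0, T]) (kern b (t - s) * u s).
Proof.
move=> tT; rewrite /kconv.
have -> : `[0, t]%classic = `[0, T]%classic `&` [set s | s <= t].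
  apply/seteqP; split => s /=; rewrite !in_itv/=.
    by move=> /andP[-> st]; rewrite (le_trans st tT).
  by move=> [/andP[-> _] ->].
rewrite Rintegral_mkcondr; apply: eq_Rintegral => s _; rewrite patchE.
case: ifPn => //; rewrite notin_setE /= => /negP; rewrite -ltNge /kern subr_gt0.
by move=> /lt_gtF ->; rewrite mul0r.
Qed.

Lemma kconvB (R : realType) (b t : R) (u v : R -> R) : 0 < b -> b < 1 ->
  continuous u -> continuous v ->
  kconv b (fun s => u s - v s) t = kconv b u t - kconv b v t.
Proof.
move=> b0 b1 cu cv; rewrite /kconv -RintegralB//; [|exact: integrable_kernM..].
by apply: eq_Rintegral => s _; rewrite mulrBr.
Qed.

Lemma kconvZ (R : realType) (b t k : R) (u : R -> R) : 0 < b -> b < 1 ->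
  continuous u -> kconv b (fun s => k * u s) t = k * kconv b u t.
Proof.
move=> b0 b1 cu; rewrite /kconv -RintegralZl//; [|exact: integrable_kernM].
by apply: eq_Rintegral => s _; rewrite mulrCA.
Qed.

Lemma kconv_cst (R : realType) (b t c : R) : 0 < b -> b < 1 -> 0 <= t ->
  kconv b (fun=> c) t = c * (t `^ b / b).
Proof.
move=> b0 b1 t0; rewrite /kconv RintegralZr//; last exact: integrable_kern.
by rewrite integral_kern// subr0 mulrC.
Qed.

Lemma kconv_ramp (R : realType) (b t t1 : R) : 0 < b -> b < 1 -> 0 <= t1 ->
  kconv b (fun s => Num.max 0 (s - t1)) t =
  Num.max 0 (t - t1) `^ (b + 1) / (b * (b + 1)).
Proof.
move=> b0 b1 t10; have b10 : 0 < b + 1 by rewrite addr_gt0.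
have [tt1|tt1] := leP t t1.
  rewrite max_l ?subr_le0// powR0 ?gt_eqF// mul0r /kconv.
  rewrite (_ : (\int[_]_(s in _) _) = \int[@lebesgue_measure R]_(s in `[0, t]) 0).
    by rewrite Rintegral_cst// mul0r.
  apply: eq_Rintegral => s; rewrite inE/= in_itv/= => /andP[_ st].
  by rewrite max_l ?mulr0// subr_le0 (le_trans st).
rewrite max_r ?subr_ge0 ?ltW// /kconv.
have cK : continuous (fun s : R => s - t1).
  by move=> s; apply: cvgB; [exact: cvg_id|exact: cvg_cst].
have -> : \int[@lebesgue_measure R]_(s in `[0, t]) (kern b (t - s) * Num.max 0 (s - t1))
  = \int[@lebesgue_measure R]_(s in `[t1, t]) (kern b (t - s) * (s - t1)).
  have -> : `[t1, t]%classic = `[0, t]%classic `&` [set s | t1 <= s].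
    apply/seteqP; split => s /=; rewrite !in_itv/=.
      by move=> /andP[st ->]; rewrite (le_trans t10 st).
    by move=> [/andP[_ ->] ->].
  rewrite Rintegral_mkcondr; apply: eq_Rintegral => s _; rewrite patchE.
  case: ifPn; rewrite ?notin_setE ?inE/= => h; first by rewrite max_r// subr_ge0.
  by rewrite max_l ?mulr0// subr_le0 ltW// ltNge; exact/negP.
(* Here s - t1 = (t - t1) - (t - s) reduces the integral to pure powers of t - s. *)
have -> : \int[@lebesgue_measure R]_(s in `[t1, t]) (kern b (t - s) * (s - t1)) =
  \int[@lebesgue_measure R]_(s in `[t1, t])
     (kern b (t - s) * (t - t1) - (t - s) `^ (b + 1 - 1)).
  apply: eq_Rintegral => s; rewrite inE/= in_itv/= => /andP[_ st].
  rewrite addrK kernE// -(mulr_powRB1 _ b0) ?subr_ge0//; ring.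
have Ip : (@lebesgue_measure R).-integrable `[t1, t]
    (EFin \o (fun s => (t - s) `^ (b + 1 - 1))).
  apply/integrableP; split; first by apply/measurable_EFinP; exact: measurable_powR_sub.
  under eq_integral => s _.
    rewrite /= ger0_norm ?powR_ge0//.
    over.
  by rewrite integral_powR ?ltry// ltW.
rewrite RintegralB//.
- rewrite RintegralZr//; last exact: integrable_kern.
  rewrite integral_kern ?ltW// /Rintegral integral_powR ?ltW//=.
  rewrite (powRD (r := b) (s := 1)); last by rewrite gt_eqF.
  rewrite powRr1 ?subr_ge0 ?ltW//.
  by field; rewrite !gt_eqF.
- by apply: integrable_kernM => //; exact: cst_continuous.
Qed.

(** t^(b + 1) - s^(b + 1) = t^b (t - s) + s (t^b - s^b), and
    s (t^b - s^b) <= t^b (t - s) since (s / t)^b >= s / t. *)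
Lemma powR_increment_le (R : realType) (b t s : R) : 0 < b -> b < 1 -> 0 <= s -> s <= t ->
  t `^ (b + 1) - s `^ (b + 1) <= 2 * t `^ b * (t - s).
Proof.
move=> b0 b1 s0 st.
have [t0|t0] := leP t 0.
  have -> : s = t by apply/eqP; rewrite eq_le st (le_trans t0).
  by rewrite !subrr mulr0.
have t0' := ltW t0.
rewrite !powRD; [|by rewrite gt_eqF// addr_gt0..].
rewrite !powRr1//.
have h : t `^ b * (s / t) <= s `^ b.
  have st1 : s / t <= 1 by rewrite ler_pdivrMr// mul1r.
  have st0 : 0 <= s / t by rewrite divr_ge0.
  have -> : s `^ b = t `^ b * (s / t) `^ b.
    by rewrite -powRM// mulrC divfK// gt_eqF.
  rewrite ler_wpM2l ?powR_ge0//.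
  have [->|sn0] := eqVneq s 0; first by rewrite mul0r powR_ge0.
  apply: ger1_powR; last exact: ltW.
  by rewrite st1 divr_gt0// lt_neqAle eq_sym sn0.
have h2 : s * (t `^ b * (s / t)) <= s * s `^ b by rewrite ler_wpM2l.
have h3 : t * (s / t) = s by rewrite mulrC divfK// gt_eqF.
have h4 : 0 <= t `^ b by exact: powR_ge0.
set p := t `^ b in h h2 h4 *; set q := s `^ b in h h2 *; set z := s / t in h h2 h3.
have z1 : z <= 1 by rewrite /z ler_pdivrMr// mul1r.
have : p * (s * z) >= p * (2 * s - t).
  rewrite ler_wpM2l//.
  have e1 : s * z = t * z * z by rewrite h3.
  have e2 : 0 <= t * ((1 - z) * (1 - z)) by rewrite mulr_ge0// mulr_ge0// subr_ge0.
  lra.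
lra.
Qed.

Lemma kconv_ramp_incr (R : realType) (b t s t1 W : R) : 0 < b -> b < 1 -> 0 <= t1 ->
  0 <= W -> s <= t -> t <= t1 + W ->
  kconv b (fun s => Num.max 0 (s - t1)) t - kconv b (fun s => Num.max 0 (s - t1)) s
    <= 2 / b * W `^ b * (t - s).
Proof.
move=> b0 b1 t10 W0 st tW; rewrite !kconv_ramp// -mulrBl.
have b10 : 0 < b + 1 by rewrite addr_gt0.
set x := Num.max 0 (t - t1); set y := Num.max 0 (s - t1).
have y0 : 0 <= y by rewrite /y le_max lexx.
have x0 : 0 <= x by rewrite /x le_max lexx.
have yx : y <= x by rewrite /x /y ge_max !le_max lexx/= lerD2r st orbT.
have xW : x <= W by rewrite /x ge_max W0/= lerBlDl.
have xy : x - y <= t - s by rewrite /x /y !maxEle; do 2 case: ifPn; lra.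
have xy0 : 0 <= x - y by rewrite subr_ge0.
have xb : x `^ b <= W `^ b by rewrite ge0_ler_powR ?nnegrE// ltW.
have h : x `^ (b + 1) - y `^ (b + 1) <= 2 * W `^ b * (t - s).
  apply: (le_trans (powR_increment_le b0 b1 y0 yx)).
  apply: ler_pM => //; first by rewrite mulr_ge0// powR_ge0.
  by rewrite ler_wpM2l.
rewrite ler_pdivrMr ?mulr_gt0//; apply: (le_trans h).
rewrite (_ : 2 / b * W `^ b * (t - s) * (b * (b + 1)) = 2 * W `^ b * (t - s) * (b + 1)).
  apply: ler_peMr; last by rewrite lerDr ltW.
  by rewrite !mulr_ge0 ?powR_ge0// subr_ge0.
by field; rewrite gt_eqF.
Qed.

(** * The extremum principle *)

(** For m h < r <= (m + 1) h the quotients of the shifted kernels by kern b r are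
    smallest at r = (m + 1) h, where the inequality is the renewal equation.  If r
    is beyond all the shifts, it suffices that the kernel decreases and that the
    weights sum to 1; this is what the last weight, the tail, is for. *)
Lemma kern_le_renewal (R : realType) (b h r : R) (M : nat) : 0 < b -> b < 1 -> 0 < h -> h < r ->
  (forall n, 0 <= renewal (pow_seq b) n) -> (forall n, 0 <= renewal_tail (renewal (pow_seq b)) n) ->
  kern b r <= \sum_(j < M) renewal (pow_seq b) j * kern b (r - j.+1%:R * h)
     + renewal_tail (renewal (pow_seq b)) M * kern b (r - M.+1%:R * h).
Proof.
move=> b0 b1 h0 hr al0 re0; have r0 := lt_trans h0 hr.
(* The case where r lies beyond all the shifts. *)
have [rM|rM] := ltP (M.+1%:R * h) r.
  have mono j : (j <= M)%N -> kern b r <= kern b (r - j.+1%:R * h).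
    move=> jM; apply: kern_antitone; first exact: ltW.
      by rewrite subr_gt0 (le_lt_trans _ rM)// ler_pM2r// ler_nat.
    by rewrite lerBlDr lerDl mulr_ge0// ltW.
  rewrite -[leLHS]mul1r.
  rewrite [X in X * _](_ : 1 = \sum_(j < M) renewal (pow_seq b) j + renewal_tail (renewal (pow_seq b)) M);
    last by rewrite /renewal_tail; lra.
  rewrite mulrDl lerD//; last by rewrite ler_wpM2l// mono.
  rewrite mulr_suml; apply: ler_sum => j _; rewrite ler_wpM2l// mono// ltnW//.
have ex : exists m : nat, r <= m.+1%:R * h by exists M.
(* This minimal m is the number of shifts smaller than r. *)
have [m rm mmin] := ex_minnP ex.
have mM := mmin _ rM.
case: m rm mmin mM => [|m] rm mmin mM; first by move: rm; rewrite mul1r leNgt hr.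
have mr : m.+1%:R * h < r.
  by rewrite ltNge; apply/negP => /mmin; rewrite ltnn.
apply: (@le_trans _ _ (\sum_(j < M) renewal (pow_seq b) j * kern b (r - j.+1%:R * h))); last first.
  by rewrite lerDl mulr_ge0// kern_ge0.
apply: (@le_trans _ _ (\sum_(j < m.+1) renewal (pow_seq b) j * kern b (r - j.+1%:R * h))); last first.
  apply: (@ler_sum_ord _ (fun j => renewal (pow_seq b) j * kern b (r - j.+1%:R * h))) => // j.
  by rewrite mulr_ge0// kern_ge0.
rewrite -(ler_pM2r (pow_seq_gt0 b m.+1)) {1}(renewalE m (pow_seq0 b)) mulr_sumr mulr_suml.
apply: ler_sum => j _; rewrite mulrCA -mulrA ler_wpM2l//.
have jm : (j <= m)%N by rewrite -ltnS.
have rj : 0 < r - j.+1%:R * h.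
  by rewrite subr_gt0 (le_lt_trans _ mr)// ler_pM2r// ler_nat.
rewrite /kern r0 rj /pow_seq -!powRM ?(ltW r0) ?(ltW rj)//.
apply: powR_antitone; [exact: ltW|by rewrite mulr_gt0|].
rewrite -subSn//.
have -> : (m.+1 - j)%:R = m.+2%:R - j.+1%:R :> R.
  by rewrite -natrB ?subSS//; exact: leqW.
have : j.+1%:R * r <= j.+1%:R * (m.+2%:R * h) by rewrite ler_wpM2l.
lra.
Qed.

Lemma Rintegral_lincomb (R : realType) (a T : R) (k : nat -> R) (f : nat -> R -> R) n :
  (forall j, (@lebesgue_measure R).-integrable `[a, T] (EFin \o f j)) ->
  (@lebesgue_measure R).-integrable `[a, T] (EFin \o (fun s => \sum_(j < n) k j * f j s)) /\
  \int[@lebesgue_measure R]_(s in `[a, T]) (\sum_(j < n) k j * f j s) =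
  \sum_(j < n) k j * \int[@lebesgue_measure R]_(s in `[a, T]) f j s.
Proof.
move=> fi; elim: n => [|n [IHi IHe]].
  split; first by apply: (eq_integrable _ (cst 0%E)); [by []|by move=> s _; rewrite /= big_ord0|exact: integrable0].
  rewrite big_ord0 (@eq_Rintegral _ _ _ _ _ (cst 0)); first by rewrite Rintegral_cst// mul0r.
  by move=> s _; rewrite big_ord0.
have fkn : (@lebesgue_measure R).-integrable `[a, T] (EFin \o (fun s => k n * f n s)).
  exact: (integrableZl _ (k n) (fi n)).
split.
  rewrite (_ : EFin \o _ = EFin \o (fun s => \sum_(j < n) k j * f j s + k n * f n s));
    last by apply/funext => s; rewrite /= big_ord_recr.
  exact: (integrableD _ IHi fkn).
rewrite big_ord_recr/= -IHe -RintegralZl// -RintegralD//.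
by apply: eq_Rintegral => s _; rewrite big_ord_recr.
Qed.

(** The increments of the convolution over the grid t0 - j h, h = d / (M + 1),
    weighted by the renewal tails, form by summation by parts the convolution of w
    with the combination of kernels in [kern_le_renewal], which is nonpositive
    except on [t0 - h, t0]. *)
Lemma kconv_extremum_step (R : realType) (b c d eta t0 : R) (w : R -> R) (M : nat) :
  0 < b -> b < 1 -> continuous w -> 0 < d -> d <= t0 -> 
  (forall n, 0 <= renewal (pow_seq b) n) -> (forall n, 0 <= renewal_tail (renewal (pow_seq b)) n) ->
  (forall s : R, 0 <= s <= t0 -> 0 <= w s) ->
  (forall s t : R, t0 - d <= s -> s <= t -> t <= t0 -> c * (t - s) <= kconv b w t - kconv b w s) ->
  (forall s : R, t0 - d / M.+1%:R <= s <= t0 -> w s <= eta) ->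
  c * (d / M.+1%:R) * (\sum_(j < M.+1) renewal_tail (renewal (pow_seq b)) j) <=
    eta * ((d / M.+1%:R) `^ b / b).
Proof.
move=> b0 b1 cw d0 dt0 al0 re0 w0 inc weta.
set h := d / M.+1%:R in weta *; set al := renewal (pow_seq b) in al0 re0 *.
have h0 : 0 < h by rewrite divr_gt0.
have hM : M.+1%:R * h = d by rewrite mulrC divfK.
pose J j := kconv b w (t0 - j%:R * h).
have jh j : 0 <= j%:R * h by rewrite mulr_ge0// ltW.
have low : c * h * (\sum_(j < M.+1) renewal_tail al j) <= \sum_(j < M.+1) renewal_tail al j * (J j - J j.+1).
  rewrite mulr_sumr; apply: ler_sum => j _; rewrite mulrC ler_wpM2l//.
  have -> : h = (t0 - j%:R * h) - (t0 - j.+1%:R * h) by rewrite -natr1; lra.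
  apply: inc.
  - by rewrite lerD2l lerN2 -hM ler_pM2r// ler_nat.
  - by rewrite lerD2l lerN2 ler_pM2r// ler_nat.
  - by rewrite lerBlDr lerDl.
apply: (le_trans low); rewrite abel_summation.
suff : J 0%N <= \sum_(j < M) al j * J j.+1 + renewal_tail al M * J M.+1 + eta * (h `^ b / b).
  by rewrite !lerBlDl addrA.
pose mu := @lebesgue_measure R.
pose f j s := kern b (t0 - j%:R * h - s) * w s.
have JE j : J j = \int[mu]_(s in `[0, t0]) f j s.
  by rewrite /J (@kconv_widen _ _ _ t0)// lerBlDr lerDl.
have fi j : mu.-integrable `[0, t0] (EFin \o f j) by exact: integrable_kernM.
have [si sE] := @Rintegral_lincomb R 0 t0 al (fun j => f j.+1) M (fun j => fi j.+1).
pose g := (fun s => kern b (t0 - s)) \_ `[t0 - h, t0].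
have ht0 : 0 <= t0 - h.
  by rewrite subr_ge0 (le_trans _ dt0)// -hM ler_peMl ?ler1n// ltW.
have subI : `[0, t0]%classic `&` `[t0 - h, t0]%classic = `[t0 - h, t0]%classic.
  apply/seteqP; split => s /=; rewrite !in_itv/=; first by case.
  by move=> /andP[hs st]; rewrite (le_trans ht0 hs) hs st.
have gi : mu.-integrable `[0, t0] (EFin \o g).
  rewrite /g -restrict_EFin.
  apply/integrable_restrict => //; rewrite subI.
  exact: integrable_kern.
have gE : \int[mu]_(s in `[0, t0]) g s = h `^ b / b.
  rewrite -Rintegral_mkcondr subI integral_kern// ?lerBlDr ?lerDl 1?ltW//.
  by congr (_ `^ _ / _); lra.
have ri : mu.-integrable `[0, t0] (EFin \o (fun s => renewal_tail al M * f M.+1 s)).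
  exact: (integrableZl _ _ (fi M.+1)).
have ei : mu.-integrable `[0, t0] (EFin \o (fun s => eta * g s)).
  exact: (integrableZl _ _ gi).
rewrite JE (eq_bigr (fun j : 'I_M => al j * \int[mu]_(s in `[0, t0]) f j.+1 s)); last first.
  by move=> j _; rewrite JE.
rewrite -sE JE -gE -RintegralZl// -RintegralZl// -RintegralD//.
have sri : mu.-integrable `[0, t0]
   (EFin \o (fun s => \sum_(j < M) al j * f j.+1 s + renewal_tail al M * f M.+1 s)).
  exact: (integrableD _ si ri).
rewrite -RintegralD//; apply: le_Rintegral => //; first exact: (integrableD _ sri ei).
move=> s /=; rewrite in_itv/= => /andP[s0 st].
have ws : 0 <= w s by rewrite w0// s0.
rewrite {1}/f mul0r subr0.
have [hs|hs] := ltP s (t0 - h).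
  have -> : g s = 0 by rewrite /g patchE memNset//= in_itv/= leNgt hs.
  rewrite mulr0 addr0 /f mulrA.
  under eq_bigr => j _ do rewrite mulrA.
  rewrite -mulr_suml -mulrDl ler_wpM2r//.
  have hts : h < t0 - s by lra.
  have := kern_le_renewal M b0 b1 h0 hts al0 re0.
  have e j : t0 - j%:R * h - s = t0 - s - j%:R * h by lra.
  rewrite e; under [in X in _ -> _ <= X]eq_bigr => j _ do rewrite e.
  by [].
have -> : g s = kern b (t0 - s) by rewrite /g patchE mem_set//= in_itv/= hs st.
rewrite -[leLHS]add0r lerD//.
  by rewrite addr_ge0 ?sumr_ge0 ?mulr_ge0 ?kern_ge0// => j _; rewrite !mulr_ge0 ?kern_ge0.
by rewrite mulrC ler_wpM2r ?kern_ge0// weta// hs st.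
Qed.

(** In [kconv_extremum_step] the left-hand side is at least of order
    (M + 1)^(- b), and so is the right-hand side except for the factor eta, which
    is arbitrarily small because w is continuous and w t0 = 0. *)
Lemma kconv_extremum (R : realType) (b c d t0 : R) (w : R -> R) :
  0 < b -> b < 1 -> continuous w -> 0 < c -> 0 < d -> d <= t0 -> 
  (forall s : R, 0 <= s <= t0 -> 0 <= w s) -> w t0 = 0 ->
  (forall s t : R, t0 - d <= s -> s <= t -> t <= t0 -> c * (t - s) <= kconv b w t - kconv b w s) ->
  False.
Proof.
move=> b0 b1 cw c0 d0 dt0 w0 wt0 inc.
have al0 := @kaluza _ (pow_seq b) (pow_seq0 b) (pow_seq_gt0 b) (fun m n => pow_seq_logconvex (ltW b1)).
have re0 := @renewal_tail_ge0 _ (pow_seq b) (pow_seq0 b) (pow_seq_gt0 b) (fun m n => pow_seq_antitone (ltW b1)) al0.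
have db : 0 < d `^ b by rewrite powR_gt0.
(* Half of the least value of eta that the step lemma, combined with the lower
   bound for the sum of the renewal tails, would allow. *)
pose eta := c * d * b * b / (4 * d `^ b).
have eta0 : 0 < eta by rewrite divr_gt0// !mulr_gt0.
have /cvgrPdist_lt/(_ _ eta0)/nbhs_ballP[e /= e0 eP] := cw t0.
have [M hM] : exists M : nat, d / M.+1%:R < e.
  exists (Num.truncn (d / e)).
  by rewrite ltr_pdivrMr// mulrC -ltr_pdivrMr// truncnS_gt.
have weta s : t0 - d / M.+1%:R <= s <= t0 -> w s <= eta.
  move=> /andP[s1 s2]; have : ball t0 e s.
    by rewrite /ball/= ger0_norm ?subr_ge0// (le_lt_trans _ hM)// lerBlDr -lerBlDl.
  move/eP; rewrite wt0 sub0r normrN => /ltW; apply: le_trans; exact: ler_norm.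
have := kconv_extremum_step b0 b1 cw d0 dt0 al0 re0 w0 inc weta.
set S := \sum_(j < _) _ => h.
have hS : b / 2 * M.+1%:R / M.+1%:R `^ b <= S by exact: renewal_tail_pow_seq_ge.
set N : R := M.+1%:R in h hS.
have N0 : 0 < N by rewrite ltr0n.
have Nb : 0 < N `^ b by rewrite powR_gt0.
have dNb : (d / N) `^ b = d `^ b / N `^ b.
  rewrite powRM ?invr_ge0 ?ltW//; congr (_ * _).
  by rewrite -(powR_inv1 (ltW N0)) powRAC powR_inv1// ltW.
have h2 : c * (d / N) * (b / 2 * N / N `^ b) <= c * (d / N) * S.
  by rewrite ler_pM2l// mulr_gt0// divr_gt0.
have := le_trans h2 h; rewrite dNb /eta.
have -> : c * (d / N) * (b / 2 * N / N `^ b) = c * d * b / N `^ b / 2.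
  by field; rewrite !gt_eqF.
have -> : c * d * b * b / (4 * d `^ b) * (d `^ b / N `^ b / b) = c * d * b / N `^ b / 4.
  by field; rewrite !gt_eqF.
have : 0 < c * d * b / N `^ b by rewrite divr_gt0// !mulr_gt0.
lra.
Qed.

(** * Scalar Caputo differential inequalities *)

(** The infimum of the times at which some phi i is nonpositive. *)
Lemma first_zero (R : realType) (I : finType) (phi : I -> R -> R) (a b : R) :
  (forall i, continuous (phi i)) -> a <= b -> (forall i, 0 < phi i a) ->
  (exists i, phi i b <= 0) ->
  exists t0, [/\ a < t0, t0 <= b, forall i s, a <= s <= t0 -> 0 <= phi i s
    & exists i, phi i t0 = 0].
Proof.
move=> cphi ab pa [ib pb].
pose S := [set t | a <= t <= b /\ exists i, phi i t <= 0].
have Sb : S b by split; [rewrite ab lexx|exists ib].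
have Slb : has_lbound S by exists a => t [/andP[]].
have hS : has_inf S by split => //; exists b.
set t0 := inf S.
have t0b : t0 <= b by exact: ge_inf.
have at0 : a <= t0 by apply: lb_le_inf; [exists b|move=> t [/andP[]]].
have pos i s : a <= s -> s < t0 -> 0 < phi i s.
  move=> as_ st; rewrite ltNge; apply/negP => h.
  have Ss : S s by split; [rewrite as_ (ltW (lt_le_trans st t0b))|exists i].
  by have := ge_inf Slb Ss; rewrite -/t0 leNgt st.
have nneg i : 0 <= phi i t0.
  rewrite leNgt; apply/negP => neg.
  have at0' : a < t0.
    rewrite lt_neqAle at0 andbT; apply/eqP => e; move: neg; rewrite -e.
    by rewrite ltNge ltW// pa.
  have neg' : 0 < - phi i t0 by rewrite oppr_gt0.
  have /cvgrPdist_lt/(_ _ neg')/nbhs_ballP[e /= e0 eP] := cphi i t0.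
  pose s := Num.max a (t0 - e / 2).
  have st : s < t0 by rewrite /s gt_max at0'/= ltrBlDr ltrDl divr_gt0.
  have := pos i s; rewrite st /s le_max lexx /= => /(_ isT isT) ps.
  have : ball t0 e s.
    rewrite /ball/= ger0_norm ?subr_ge0 ?ltW//.
    have : t0 - e / 2 <= s by rewrite /s le_max lexx orbT.
    lra.
  move/eP; rewrite -/s in ps *; move=> h.
  have := ler_norm (- (phi i t0 - phi i s)); rewrite normrN; lra.
have ex : exists i, phi i t0 <= 0.
  apply: contrapT => nex.
  have pt i : 0 < phi i t0 by rewrite ltNge; apply/negP => h; apply: nex; exists i.
  have : \forall s \near t0, forall i, 0 < phi i s.
    apply: (@filter_forall _ _ (fun i s => 0 < phi i s) (nbhs t0)) => i.
    exact: (cvgr_gt (phi i t0) (cphi i t0)).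
  move/nbhs_ballP => [e /= e0 eP].
  have [s Ss st] := inf_adherent e0 hS.
  have ts : t0 <= s by exact: ge_inf.
  case: (Ss) => [_ [i his]]; move: his; rewrite leNgt => /negP; apply.
  apply: eP.
  by rewrite /ball/= ler0_norm ?subr_le0//; rewrite -/t0 in st; lra.
have [i hi] := ex.
have e0 : phi i t0 = 0 by apply/eqP; rewrite eq_le hi nneg.
have at0' : a < t0.
  rewrite lt_neqAle at0 andbT; apply/eqP => e; move: (pa i); rewrite e e0 ltxx//.
exists t0; split => //; last by exists i.
move=> j s /andP[as_]; rewrite le_eqVlt => /predU1P[->//|st].
by apply: ltW; exact: pos.
Qed.

Lemma continuous_ramp (R : realType) (k t1 : R) :
  continuous (fun s : R => Num.max k (s - t1)).
Proof.
move=> s; have h1 : {for s, continuous (fun=> k : R)} by exact: cvg_cst.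
have h2 : {for s, continuous (fun s : R => s - t1)}.
  by apply: cvgB; [exact: cvg_id|exact: cvg_cst].
exact: (@continuous_max R R (fun=> k) (fun s => s - t1) s h1 h2).
Qed.

(** Bounds the Caputo derivative of order alpha of a ramp of slope 1 during the
    time W after its start. *)
Definition ramp_bound (R : realType) (alpha W : R) : R :=
  if alpha == 1 then 1 else (Gamma (1 - alpha))^-1 * (2 / (1 - alpha) * W `^ (1 - alpha)).

Lemma Gamma_ge0 (R : realType) (a : R) : 0 <= Gamma a.
Proof.
by apply: Rintegral_ge0 => s _; rewrite mulr_ge0 ?powR_ge0 ?expR_ge0.
Qed.

Lemma caputo_prim1 (R : realType) (u : R -> R) t : caputo_prim 1 u t = u t - u 0.
Proof. by rewrite /caputo_prim /fracint subrr eqxx. Qed.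

Lemma caputo_primE (R : realType) (alpha : R) (u : R -> R) t : 0 < alpha -> alpha < 1 ->
  caputo_prim alpha u t =
   (Gamma (1 - alpha))^-1 * kconv (1 - alpha) (fun s => u s - u 0) t.
Proof.
move=> a0 a1; rewrite /caputo_prim /fracint subr_eq0 gt_eqF//; congr (_ * _).
apply: eq_Rintegral => s; rewrite inE/= in_itv/= => /andP[_ st].
by rewrite kernE// ltrBlDr ltrDl.
Qed.

Lemma caputo_prim_shift (R : realType) (a c : R) (u : R -> R) :
  caputo_prim a (fun s => u s - c) = caputo_prim a u.
Proof.
rewrite /caputo_prim; congr fracint; apply/funext => s; lra.
Qed.

Lemma caputo_prim_eq (R : realType) (a t : R) (u v : R -> R) :
  (forall s, 0 <= s -> u s = v s) -> 0 <= t -> caputo_prim a u t = caputo_prim a v t.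
Proof.
move=> uv t0; rewrite /caputo_prim /fracint; case: ifP => _; first by rewrite !uv.
congr (_ * _); apply: eq_Rintegral => s; rewrite inE/= in_itv/= => /andP[s0 _].
by rewrite !uv.
Qed.

(** Allows for replacing a solution by its continuous extension, see
    [continuous_clamp]. *)
Lemma caputo_eq (R : realType) (a t : R) (u v : R -> R) :
  (forall s, 0 <= s -> u s = v s) -> 0 < t -> caputo_derivable a u t ->
  caputo_derivable a v t /\ caputo a v t = caputo a u t.
Proof.
move=> uv t0 du.
have near_eq : {near t, caputo_prim a u =1 caputo_prim a v}.
  by near=> s; apply: caputo_prim_eq => //; apply: ltW; near: s; exact: lt_nbhsr.
split; first exact: near_eq_derivable du.
by rewrite /caputo !derive1E; apply/esym; exact: near_eq_derive.
Unshelve. all: by end_near. Qed.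

Lemma caputo_primN (R : realType) (a : R) (u : R -> R) : 0 < a <= 1 -> continuous u ->
  caputo_prim a (fun s => - u s) = - caputo_prim a u.
Proof.
move=> /andP[a0 a1] cu; apply/funext => t; rewrite -[RHS]/(- caputo_prim a u t).
have [->|an1] := eqVneq a 1.
  by rewrite !caputo_prim1; lra.
have a1' : a < 1 by rewrite lt_neqAle an1.
rewrite !caputo_primE// -mulrN; congr (_ * _).
have cu0 : continuous (fun s => u s - u 0).
  by move=> s; apply: cvgB; [exact: cu|exact: cvg_cst].
rewrite -mulN1r -kconvZ//; [|by rewrite subr_gt0|by rewrite ltrBlDr ltrDl].
congr kconv; apply/funext => s; lra.
Qed.

Lemma caputoN (R : realType) (a t : R) (u : R -> R) : 0 < a <= 1 -> continuous u ->
  caputo_derivable a u t ->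
  caputo_derivable a (fun s => - u s) t /\ caputo a (fun s => - u s) t = - caputo a u t.
Proof.
move=> ha cu du; rewrite /caputo_derivable /caputo caputo_primN// !derive1E.
by split; [exact: derivableN|rewrite deriveN].
Qed.

(** Suppose that x meets the barrier K - lam max(0, t - t1) from below at t0.
    If the Caputo derivative of x is at most - c near t0, and that of the barrier is
    larger, then w, the barrier minus x, contradicts the extremum principle.  The
    factor 1 / Gamma (1 - alpha) only needs to be nonnegative: if it is zero, so are
    all the increments. *)
Lemma caputo_touch_ramp (R : realType) (alpha c d t0 t1 K lam W : R) (x : R -> R) :
  0 < alpha <= 1 -> continuous x -> 0 <= t1 -> 0 <= lam -> 0 <= W ->
  0 < d -> d < t0 -> t0 <= t1 + W ->
  (forall s, 0 <= s <= t0 -> x s <= K - lam * Num.max 0 (s - t1)) ->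
  x t0 = K - lam * Num.max 0 (t0 - t1) ->
  (forall t, t0 - d <= t <= t0 -> caputo_derivable alpha x t /\ caputo alpha x t <= - c) ->
  lam * ramp_bound alpha W < c -> False.
Proof.
move=> /andP[a0 a1] cx t10 lam0 W0 d0 dt0 tW xp xt0 dx hc.
have incr s t : t0 - d <= s -> s <= t -> t <= t0 ->
    c * (t - s) <= caputo_prim alpha x s - caputo_prim alpha x t.
  move=> ds st tt0.
  have dP y : y \in `[s, t] -> derivable (caputo_prim alpha x) y 1.
    rewrite in_itv/= => /andP[sy yt]; apply: (dx _ _).1.
    by rewrite (le_trans ds sy) (le_trans yt tt0).
  have [|| y] := @MVT_segment _ (caputo_prim alpha x) (caputo alpha x) s t st.
  - move=> y yst; rewrite /caputo derive1E; apply: DeriveDef => //; apply: dP.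
    exact: subset_itv_oo_cc.
  - by apply: derivable_within_continuous => y; exact: dP.
  rewrite in_itv/= => /andP[sy yt] e.
  have [_ hy] : caputo_derivable alpha x y /\ caputo alpha x y <= - c.
    by apply: dx; rewrite (le_trans ds sy) (le_trans yt tt0).
  by rewrite -(opprB (caputo_prim alpha x t)) e -mulNr ler_wpM2r ?subr_ge0// lerNr.
(* For alpha = 1, [incr] at the endpoints t0 - d and t0 is already contradictory. *)
move: hc; rewrite /ramp_bound; have [a1'|an1] := eqVneq alpha 1.
  rewrite mulr1 => lc.
  have := incr (t0 - d) t0; rewrite !a1' !caputo_prim1 => /(_ (lexx _)).
  rewrite lerBlDr lerDl => /(_ (ltW d0) (lexx _)).
  have : x (t0 - d) <= K - lam * Num.max 0 (t0 - d - t1) by apply: xp; apply/andP; split; lra.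
  rewrite xt0.
  have h : Num.max 0 (t0 - t1) - Num.max 0 (t0 - d - t1) <= d.
    by rewrite !maxEle; do 2 case: ifPn; lra.
  have : lam * (Num.max 0 (t0 - t1) - Num.max 0 (t0 - d - t1)) <= lam * d by rewrite ler_wpM2l.
  have : 0 < (c - lam) * d by rewrite mulr_gt0// subr_gt0.
  lra.
have al1 : alpha < 1 by rewrite lt_neqAle an1.
set b := 1 - alpha; set g := (Gamma b)^-1.
have b0 : 0 < b by rewrite subr_gt0.
have b1 : b < 1 by rewrite ltrBlDr ltrDl.
have g0 : 0 <= g by rewrite invr_ge0 Gamma_ge0.
move=> lc.
pose p s := K - lam * Num.max 0 (s - t1).
pose w s := p s - x s.
(* Caputo increments are those of the convolution with functions shifted to
   vanish at 0; the shift K - x 0 of w is nonnegative and only adds growth. *)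
have cr : continuous (fun s : R => Num.max 0 (s - t1)).
  exact: continuous_ramp.
have clr : continuous (fun s : R => lam * Num.max 0 (s - t1)).
  by move=> s; apply: cvgM; [exact: cvg_cst|exact: cr].
have cx0 : continuous (fun s : R => x s - x 0).
  by move=> s; apply: cvgB; [exact: cx|exact: cvg_cst].
have cst1 : continuous (fun s : R => K - x 0) by exact: cst_continuous.
have c2 : continuous (fun s : R => (K - x 0) - lam * Num.max 0 (s - t1)).
  by move=> s; apply: cvgB; [exact: cvg_cst|exact: clr].
have wE : w = fun s => ((K - x 0) - lam * Num.max 0 (s - t1)) - (x s - x 0).
  by apply/funext => s; rewrite /w /p; lra.
have cw : continuous w.
  by rewrite wE => s; apply: cvgB; [exact: c2|exact: cx0].
have Kx0 : 0 <= K - x 0.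
  have := xp 0; rewrite lexx /= sub0r max_l ?oppr_le0// mulr0 subr0 subr_ge0; apply.
  by apply: ltW; exact: lt_trans dt0.
have td0 : 0 <= t0 - d by rewrite subr_ge0 ltW.
have kwE t : 0 <= t -> kconv b w t = (K - x 0) * (t `^ b / b)
    - lam * kconv b (fun s => Num.max 0 (s - t1)) t - kconv b (fun s => x s - x 0) t.
  move=> t00; rewrite wE (kconvB t b0 b1 c2 cx0) (kconvB t b0 b1 cst1 clr).
  by rewrite (kconv_cst _ b0 b1 t00) (kconvZ _ _ b0 b1 cr).
have inc2 s t : t0 - d <= s -> s <= t -> t <= t0 ->
    (c - lam * (g * (2 / b * W `^ b))) * (t - s) <= g * (kconv b w t - kconv b w s).
  move=> ds st tt0; have s0 := le_trans td0 ds; have t00 := le_trans s0 st.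
  rewrite !kwE//.
  have h1 := incr _ _ ds st tt0; rewrite !caputo_primE// -/b -/g in h1.
  have h2 := kconv_ramp_incr b0 b1 t10 W0 st (le_trans tt0 tW).
  have h3 : g * lam * (kconv b (fun s => Num.max 0 (s - t1)) t -
     kconv b (fun s => Num.max 0 (s - t1)) s) <= g * lam * (2 / b * W `^ b * (t - s)).
    by rewrite ler_wpM2l// mulr_ge0.
  have h4 : 0 <= g * ((K - x 0) * ((t `^ b - s `^ b) / b)).
    apply: mulr_ge0 => //; apply: mulr_ge0 => //; apply: divr_ge0; last exact: ltW.
    by rewrite subr_ge0 ge0_ler_powR ?nnegrE// ltW.
  move: h1 h3 h4 {lc incr h2 kwE dx xp xt0 wE}.
  move: (kconv b (fun s => Num.max 0 (s - t1))) (kconv b (fun s => x s - x 0)) => kr kx.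
  move: (W `^ b) (t `^ b) (s `^ b) => Wb tb sb; lra.
have [gz|gnz] := eqVneq g 0.
  have := inc2 (t0 - d) t0 (lexx _); rewrite lerBlDr lerDl => /(_ (ltW d0) (lexx _)).
  rewrite gz !mul0r mulr0 subr0.
  have : 0 < c * d by rewrite mulr_gt0//; move: lc; rewrite gz !mul0r mulr0.
  lra.
have gp : 0 < g by rewrite lt_neqAle eq_sym gnz.
apply: (@kconv_extremum _ b ((c - lam * (g * (2 / b * W `^ b))) / g) d t0 w) => //.
- by rewrite divr_gt0// subr_gt0.
- exact: ltW.
- by move=> s hs; rewrite subr_ge0; exact: xp.
- by rewrite /w /p xt0 subrr.
- move=> s t ds st tt0; rewrite mulrAC ler_pdivrMr// mulrC.
  by rewrite [leRHS]mulrC mulrC; exact: inc2.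
Qed.

(** Descending by D over the time W costs D W^(- alpha) up to a constant. *)
Lemma ramp_bound_small (R : realType) (alpha D eps : R) : 0 < alpha <= 1 -> 0 < eps -> 0 <= D ->
  exists2 W, 0 < W & D / W * ramp_bound alpha W < eps.
Proof.
move=> /andP[a0 a1] e0 D0; rewrite /ramp_bound; have [_|an1] := eqVneq alpha 1.
  have W0 : 0 < D / eps + 1 by rewrite ltr_wpDl// divr_ge0 ?(ltW e0).
  exists (D / eps + 1) => //.
  rewrite mulr1 ltr_pdivrMr//.
  by rewrite mulrDr mulr1 mulrCA divff ?gt_eqF// mulr1 ltrDl.
have al1 : alpha < 1 by rewrite lt_neqAle an1.
set b := 1 - alpha; set g := (Gamma b)^-1.
have b0 : 0 < b by rewrite subr_gt0.
have g0 : 0 <= g by rewrite invr_ge0 Gamma_ge0.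
pose C := D * g * (2 / b).
have C0 : 0 <= C by rewrite !mulr_ge0// invr_ge0 ltW.
pose eta := eps / (C + 1).
have eta0 : 0 < eta by rewrite divr_gt0// ltr_wpDl.
(* So that W `^ (- alpha) = eta. *)
pose W := eta `^ (- alpha^-1).
have W0 : 0 < W by rewrite powR_gt0.
exists W => //.
have e1 : W `^ b = eta * W.
  rewrite /b powRD; last by rewrite gt_eqF ?implybT.
  rewrite powRr1 ?ltW// mulrC; congr (_ * _).
  by rewrite /W -powRrM mulrNN mulVf ?gt_eqF// powRr1 ?ltW.
rewrite e1 (_ : _ * _ = C * eta); last by rewrite /C; field; rewrite !gt_eqF.
rewrite /eta mulrA ltr_pdivrMr ?ltr_wpDl// mulrC ltr_pM2l// ltrDl//.
Qed.

(** If x exceeds L' at a late time t2, put the end of the descending ramp at t2 and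
    look at the first time t0 at which x meets it.  The ramp starts above K, hence
    t0 lies on its slope, and the height of the ramp there is at least L'; so
    D^alpha x <= - a L' + L up to a small error near t0, which is less than what
    [caputo_touch_ramp] allows. *)
Lemma caputo_asymp_bound (R : realType) (alpha a K T L L' : R) (x : R -> R) :
  0 < alpha <= 1 -> continuous x -> 0 < a -> 0 <= T ->
  (forall t, 0 <= t -> x t <= K) ->
  (forall t, T < t -> caputo_derivable alpha x t /\ caputo alpha x t <= - a * x t + L) ->
  L < a * L' ->
  exists T', forall t, T' <= t -> x t <= L'.
Proof.
move=> ha cx a0 T0 xK dx LL.
pose eps := a * L' - L; have eps0 : 0 < eps by rewrite subr_gt0.
pose K' := Num.max K L' + 1.
have K'L : L' < K' by rewrite /K' ltr_pwDr// le_max lexx orbT.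
have K'K : K < K' by rewrite /K' ltr_pwDr// le_max lexx.
have D0 : 0 <= K' - L' by rewrite subr_ge0 ltW.
have e20 : 0 < eps / 2 by rewrite divr_gt0.
have [W W0 hW] := ramp_bound_small ha e20 D0.
exists (T + W + 1) => t2 htt; rewrite leNgt; apply/negP => xtt.
pose t1 := t2 - W; pose lam := (K' - L') / W.
have t1T : T + 1 <= t1 by rewrite /t1; lra.
have t10 : 0 <= t1 by lra.
have lam0 : 0 <= lam by rewrite divr_ge0// ltW.
pose p s := K' - lam * Num.max 0 (s - t1).
have cp : continuous p.
  move=> s; apply: cvgB; first exact: cvg_cst.
  apply: cvgM; first exact: cvg_cst.
  exact: continuous_ramp.
have pE s : s <= t1 -> p s = K'.
  by move=> st; rewrite /p max_l ?mulr0 ?subr0// subr_le0.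
have lW : lam * W = K' - L' by rewrite /lam divfK// gt_eqF.
have pL s : s <= t2 -> L' <= p s.
  move=> st; have : lam * Num.max 0 (s - t1) <= lam * W.
    by rewrite ler_wpM2l// ge_max ltW//= /t1; lra.
  rewrite /p; lra.
have ptt : p t2 = L'.
  by rewrite /p max_r /t1; [rewrite (_ : t2 - _ = W)|]; lra.
have [||||t0 [t00 t0tt pos [_ /eqP]]] := @first_zero _ unit (fun _ s => p s - x s) 0 t2.
- by move=> _ s; apply: cvgB; [exact: cp|exact: cx].
- lra.
- by move=> _; rewrite pE// subr_gt0 (le_lt_trans _ K'K)// xK.
- by exists tt; rewrite ptt subr_le0 ltW.
rewrite subr_eq0 => /eqP pxt0.
have t1t0 : t1 < t0.
  rewrite ltNge; apply/negP => /pE e; move: K'K; rewrite -e pxt0 ltNge xK//.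
  exact: ltW.
have ea0 : 0 < eps / (2 * a) by rewrite divr_gt0// mulr_gt0.
have /cvgrPdist_lt/(_ _ ea0)/nbhs_ballP[e /= e0 eP] := cx t0.
pose d := Num.min (e / 2) (1 / 2).
have d0 : 0 < d by rewrite lt_min !divr_gt0.
have de : d <= e / 2 by rewrite ge_min lexx.
have d1 : d <= 1 / 2 by rewrite ge_min lexx orbT.
apply: (@caputo_touch_ramp _ alpha (eps / 2) d t0 t1 K' lam W x) => //.
- exact: ltW.
- lra.
- by rewrite /t1; lra.
- by move=> s hs; rewrite -subr_ge0; exact: (pos tt).
- move=> t /andP[tl tr]; have [] := dx t; first lra.
  move=> h1 h2; split => //; apply: (le_trans h2).
  have : ball t0 e t by rewrite /ball/= ger0_norm ?subr_ge0//; lra.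
  move/eP => /(le_lt_trans (ler_norm _)) h.
  have : a * (x t0 - x t) <= a * (eps / (2 * a)) by rewrite ler_pM2l// ltW.
  have -> : a * (eps / (2 * a)) = eps / 2 by field; rewrite gt_eqF.
  have := pL _ t0tt; rewrite pxt0 => hL.
  have : a * L' <= a * x t0 by rewrite ler_pM2l.
  have : eps = a * L' - L by []; move: eps {h eps0 e20 hW ea0 eP} => eps; lra.
Qed.

(** * Decay of subsolutions of the delay system *)

(** The differential inequalities that the deviation from an equilibrium, or its
    opposite, satisfies after time T. *)
Definition subsystem (R : realType) (d n : nat) (alpha : 'I_d -> R)
    (A B : 'M[R]_d) (E : 'M[R]_(d, n)) (C : 'M[R]_(n, d)) (D : 'M[R]_n)
    (tau1 tau2 tau3 : R -> R) (T : R) (F : 'cV[R]_d) (G : 'cV[R]_n)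
    (X : R -> 'cV[R]_d) (Y : R -> 'cV[R]_n) : Prop :=
  [/\ (forall i, continuous (fun t => X t i 0)) /\ (forall i, continuous (fun t => Y t i 0)),
      forall i t, T < t -> caputo_derivable (alpha i) (fun s => X s i 0) t /\
         caputo (alpha i) (fun s => X s i 0) t <=
           (A *m X t + B *m X (t - tau1 t) + E *m Y (t - tau2 t) + F) i 0
    & forall i t, T <= t -> Y t i 0 <= (C *m X t + D *m Y (t - tau3 t) + G) i 0].

Lemma bounded_above_segment (R : realType) (u : R -> R) (a b : R) : continuous u ->
  exists K, forall t, a <= t <= b -> u t <= K.
Proof.
move=> cu; have [M [_ hM]] := continuous_bounded_segment a b cu.
exists (M + 1) => t ht; apply: le_trans (ler_norm _) _.
by apply: (hM (M + 1)) => //=; rewrite ltrDl.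
Qed.

Lemma finite_upward (R : realType) (I : finType) (P : I -> R -> Prop) :
  (forall i s t, s <= t -> P i s -> P i t) -> (forall i, exists T, P i T) ->
  exists T, forall i, P i T.
Proof.
move=> mono ex; have [f fP] := choice ex.
exists (\sum_i `|f i|) => i; apply: mono (fP i).
apply: le_trans (ler_norm _) _; exact: ler_norm_sum_mem.
Qed.

Lemma delay_eventually (R : realType) (r : R) (tau : R -> R) (T : R) : delay r tau ->
  exists T', forall t, T' <= t -> T <= t - tau t.
Proof.
move=> [_ _ _ /cvgryPge/(_ T)[M [_ hM]]].
by exists (M + 1) => t ht; apply: hM; rewrite (lt_le_trans _ ht)// ltrDl.
Qed.

(** For large K, the multiple K (v, w) lies strictly above the initial data and is a
    strict supersolution.  Consider the first time at which a component of (X, Y)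
    meets it.  A component of Y cannot, by its algebraic inequality; for a component
    of X, the derivative would be negative just before that time, in contradiction
    with [caputo_touch_ramp] for a horizontal barrier. *)
Lemma subsystem_bounded (R : realType) (d n : nat) (r : R) (alpha : 'I_d -> R)
    (A B : 'M[R]_d) (E : 'M[R]_(d, n)) (C : 'M[R]_(n, d)) (D : 'M[R]_n)
    (tau1 tau2 tau3 : R -> R) (F : 'cV[R]_d) (G : 'cV[R]_n)
    (X : R -> 'cV[R]_d) (Y : R -> 'cV[R]_n) (v : 'cV[R]_d) (w : 'cV[R]_n) :
  0 < r -> (forall i, 0 < alpha i <= 1) ->
  delay r tau1 -> delay r tau2 -> delay r tau3 ->
  metzler A -> nonneg_mx B -> nonneg_mx C -> nonneg_mx D -> nonneg_mx E ->
  (forall i, 0 < v i 0) -> (forall i, 0 < w i 0) ->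
  (forall i, (A *m v + B *m v + E *m w) i 0 < 0) ->
  (forall i, (C *m v + D *m w) i 0 < w i 0) ->
  subsystem alpha A B E C D tau1 tau2 tau3 0 F G X Y ->
  exists2 K, 0 < K & forall t, - r <= t ->
    (forall i, X t i 0 <= K * v i 0) /\ (forall i, Y t i 0 <= K * w i 0).
Proof.
move=> r0 ha [_ t1p t1r _] [_ t2p t2r _] [_ t3p t3r _] mA B0 C0 D0 E0 v0 w0 hv hw
  [[cX cY] dX eY].
pose q (k : 'I_d + 'I_n) := match k with inl i => v i 0 | inr i => w i 0 end.
pose Z (k : 'I_d + 'I_n) t := match k with inl i => X t i 0 | inr i => Y t i 0 end.
have q0 k : 0 < q k by case: k => i; rewrite /q.
have cZ k : continuous (Z k) by case: k => i; rewrite /Z.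
pose P k K := 0 < K /\ [/\ forall t, - r <= t <= 0 -> Z k t < K * q k &
   match k with
   | inl i => K * (A *m v + B *m v + E *m w) i 0 + F i 0 < 0
   | inr i => K * (C *m v + D *m w) i 0 + G i 0 < K * w i 0 end].
have [K] : exists K, forall k, P k K.
  apply: finite_upward.
    move=> k s t st [s0 [h1 h2]]; split; first exact: lt_le_trans st.
    split; first by move=> u hu; apply: (lt_le_trans (h1 u hu)); rewrite ler_pM2r.
    case: k h2 {h1} => i.
      apply: le_lt_trans; rewrite lerD2r ler_wnM2r//; exact: ltW.
    have := hw i; set a := (_ + _ : 'cV[R]_n) i 0 => aw h.
    have : 0 <= (t - s) * (w i 0 - a) by rewrite mulr_ge0 ?subr_ge0// ltW.
    lra.
  move=> k; have [M hM] := bounded_above_segment (- r) 0 (cZ k).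
  pose m := match k with
    | inl i => - (A *m v + B *m v + E *m w) i 0
    | inr i => w i 0 - (C *m v + D *m w) i 0 end.
  pose g := match k with inl i => F i 0 | inr i => G i 0 end.
  have m0 : 0 < m by rewrite /m; case: (k) => i; rewrite ?oppr_gt0 ?subr_gt0.
  pose K1 := `|M| / q k; pose K2 := `|g| / m.
  have K10 : 0 <= K1 by rewrite divr_ge0// ltW.
  have K20 : 0 <= K2 by rewrite divr_ge0// ltW.
  have K1E : K1 * q k = `|M| by rewrite divfK// gt_eqF.
  have K2E : K2 * m = `|g| by rewrite divfK// gt_eqF.
  exists (1 + K1 + K2); split; first by rewrite -addrA ltr_pwDl// addr_ge0.
  split.
    move=> t ht; apply: le_lt_trans (hM t ht) _.
    have := ler_norm M; have := q0 k; have : 0 <= K2 * q k by rewrite mulr_ge0// ltW.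
    lra.
  have : g < (1 + K1 + K2) * m.
    have := ler_norm g; have : 0 <= K1 * m by rewrite mulr_ge0// ltW.
    lra.
  by rewrite /g /m; case: (k) => i; lra.
move=> KP.
(* The bound K is only known to be positive if there is at least one component. *)
have K0 : 0 < K \/ (forall (k : 'I_d + 'I_n), False).
  have [k|] := pickP (fun k : 'I_d + 'I_n => true); first by left; case: (KP k).
  by move=> h; right => k; have := h k.
case: K0 => [K0|noI]; last first.
  exists 1 => // t _; split=> i; [case: (noI (inl i))|case: (noI (inr i))].
exists K => // t rt.
suff Zb k : Z k t <= K * q k.
  by split => i; [have := Zb (inl i)|have := Zb (inr i)].
rewrite leNgt; apply/negP => Zk.
pose phi k s := K * q k - Z k s.
have cphi k' : continuous (phi k').
  by move=> s; apply: cvgB; [exact: cvg_cst|exact: cZ].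
have neg s k' : - r <= s <= 0 -> 0 < phi k' s.
  by move=> hs; rewrite subr_gt0; have [_ [h _]] := KP k'; exact: h.
have [||t0 [rt0 t0t pos [k0 k0e]]] := @first_zero _ _ phi (- r) t cphi rt.
- by move=> k'; apply: neg; rewrite lexx lerNl oppr0 ltW.
- by exists k; rewrite subr_le0 ltW.
have t00 : 0 < t0.
  rewrite ltNge; apply/negP => h; have := @neg t0 k0.
  by rewrite k0e ltxx (ltW rt0) h => /(_ isT).
have posZ s k' : - r <= s -> s <= t0 -> Z k' s <= K * q k'.
  by move=> h1 h2; have := pos k' s; rewrite h1 h2 subr_ge0; apply.
have XZ s i : - r <= s -> s <= t0 -> X s i 0 <= (K *: v) i 0.
  by move=> h1 h2; rewrite mxE; exact: (posZ s (inl i)).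
have YZ s i : - r <= s -> s <= t0 -> Y s i 0 <= (K *: w) i 0.
  by move=> h1 h2; rewrite mxE; exact: (posZ s (inr i)).
have nr s : 0 <= s -> - r <= s by move=> s0; rewrite (le_trans _ s0)// oppr_le0 ltW.
case: k0 k0e => i /eqP; rewrite subr_eq0 => /eqP/= k0e; last first.
  have [_ [_ h]] := KP (inr i).
  have := eY i t0 (ltW t00); rewrite -k0e.
  have h1 : (C *m X t0) i 0 <= (C *m (K *: v)) i 0.
    by apply: mulmx_mono => // j; apply: XZ => //; rewrite nr// ltW.
  have h3 : (D *m Y (t0 - tau3 t0)) i 0 <= (D *m (K *: w)) i 0.
    apply: mulmx_mono => // j; apply: YZ; first exact/t3r/ltW.
    by rewrite lerBlDr lerDl; exact/t3p/ltW.
  move: h h1 h3; rewrite -!scalemxAr !mxE; lra.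
have [_ [_ h]] := KP (inl i).
pose c := - (K * (A *m v + B *m v + E *m w) i 0 + F i 0) / 2.
have c0 : 0 < c by rewrite divr_gt0// oppr_gt0.
have cA : {for t0, continuous (fun s => A i i * X s i 0)}.
  by apply: cvgM; [exact: cvg_cst|exact: (cX i)].
have /cvgrPdist_lt/(_ _ c0)/nbhs_ballP[e /= e0 eP] := cA.
pose dl := Num.min (e / 2) (t0 / 2).
have dl0 : 0 < dl by rewrite lt_min !divr_gt0.
have dle : dl <= e / 2 by rewrite ge_min lexx.
have dlt : dl <= t0 / 2 by rewrite ge_min lexx orbT.
apply: (@caputo_touch_ramp _ (alpha i) c dl t0 0 (K * v i 0) 0 t0 (fun s => X s i 0)) => //.
- exact: ltW.
- lra.
- by rewrite add0r.
- move=> s /andP[s0 st]; rewrite mul0r subr0; exact: (posZ s (inl i) (nr _ s0) st).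
- by rewrite mul0r subr0 -k0e.
- move=> s /andP[s1 s2]; have s0 : 0 < s by lra.
  have [h1 h2] := dX i s s0; split=> //; apply: (le_trans h2).
  have a1 : (A *m X s) i 0 <= (A *m (K *: v)) i 0 + A i i * (X s i 0 - (K *: v) i 0).
    by apply: metzler_mono => // j; apply: XZ => //; rewrite nr// ltW.
  have a2 : (B *m X (s - tau1 s)) i 0 <= (B *m (K *: v)) i 0.
    apply: mulmx_mono => // j; apply: XZ; first exact/t1r/ltW.
    by rewrite lerBlDr (le_trans s2)// lerDl; exact/t1p/ltW.
  have a3 : (E *m Y (s - tau2 s)) i 0 <= (E *m (K *: w)) i 0.
    apply: mulmx_mono => // j; apply: YZ; first exact/t2r/ltW.
    by rewrite lerBlDr (le_trans s2)// lerDl; exact/t2p/ltW.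
  have : ball t0 e s by rewrite /ball/= ger0_norm ?subr_ge0//; lra.
  move/eP; rewrite distrC => /ltW/(le_trans (ler_norm _)) a4.
  have vE : (K *: v) i 0 = X t0 i 0 by rewrite mxE k0e.
  rewrite vE mulrBr in a1.
  have cE : c = - (K * (A *m v + B *m v + E *m w) i 0 + F i 0) / 2 by [].
  move: a1 a2 a3 cE; rewrite -!scalemxAr ![(_ *: _ : 'cV[R]_d) i 0]mxE ![(_ + _ : 'cV[R]_d) i 0]mxE.
  lra.
- by rewrite mul0r.
Qed.

(** The strict inequalities for (v, w) leave some room: bounding all the terms by
    their values on s (v, w), except the diagonal term A_ii x_i with A_ii < 0,
    yields D^alpha x_i <= A_ii x_i + L with L < - A_ii theta s v_i. *)
Lemma subsystem_contract (R : realType) (d n : nat) (r : R) (alpha : 'I_d -> R)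
    (A B : 'M[R]_d) (E : 'M[R]_(d, n)) (C : 'M[R]_(n, d)) (D : 'M[R]_n)
    (tau1 tau2 tau3 : R -> R) (v : 'cV[R]_d) (w : 'cV[R]_n) :
  (forall i, 0 < alpha i <= 1) ->
  delay r tau1 -> delay r tau2 -> delay r tau3 ->
  metzler A -> nonneg_mx B -> nonneg_mx C -> nonneg_mx D -> nonneg_mx E ->
  (forall i, 0 < v i 0) -> (forall i, 0 < w i 0) ->
  (forall i, (A *m v + B *m v + E *m w) i 0 < 0) ->
  (forall i, (C *m v + D *m w) i 0 < w i 0) ->
  exists2 th, 0 < th < 1 & forall (T s K : R) (X : R -> 'cV[R]_d) (Y : R -> 'cV[R]_n),
    0 <= T -> 0 < s ->
    subsystem alpha A B E C D tau1 tau2 tau3 T 0 0 X Y ->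
    (forall t i, 0 <= t -> X t i 0 <= K) ->
    (forall t, T <= t -> (forall i, X t i 0 <= s * v i 0) /\ (forall i, Y t i 0 <= s * w i 0)) ->
    exists T', forall t, T' <= t ->
      (forall i, X t i 0 <= th * s * v i 0) /\ (forall i, Y t i 0 <= th * s * w i 0).
Proof.
move=> ha d1 d2 d3 mA B0 C0 D0 E0 v0 w0 hv hw.
have Bv0 i : 0 <= (B *m v) i 0.
  by apply: mulmx_nonneg => // k j; rewrite (ord1 j) ltW.
have Ew0 i : 0 <= (E *m w) i 0.
  by apply: mulmx_nonneg => // k j; rewrite (ord1 j) ltW.
have Aii i : A i i < 0.
  have h : A i i * v i 0 <= (A *m v) i 0.
    rewrite mxE (bigD1 i)//= lerDl sumr_ge0// => j ji.
    by rewrite mulr_ge0 ?mA// 1?eq_sym// ltW.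
  have : A i i * v i 0 < 0.
    have := hv i; have := Bv0 i; have := Ew0 i; rewrite ![(_ + _ : 'cV[R]_d) i 0]mxE; lra.
  by rewrite pmulr_llt0.
(* 1 - theta has to be at most each of these quotients: the relative room in the
   inequalities for v (halved, to keep one of them strict) and for w; the value
   at None keeps theta positive. *)
pose m (k : option ('I_d + 'I_n)) := match k with
  | Some (inl i) => - (A *m v + B *m v + E *m w) i 0 / (- A i i * v i 0) / 2
  | Some (inr i) => (w i 0 - (C *m v + D *m w) i 0) / w i 0
  | None => 1 / 2 end.
have m0 k : 0 < m k.
  rewrite /m; case: k => [[i|i]|]; last by rewrite divr_gt0.
    by rewrite divr_gt0// divr_gt0 ?oppr_gt0// mulr_gt0// oppr_gt0.
  by rewrite divr_gt0// subr_gt0.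
have [ka ka0 kaP] := finite_pos_lower_bound m0.
exists (1 - ka).
  by have := kaP None; rewrite /m => h; apply/andP; split; lra.
move=> T s K X Y T0 s0 [[cX cY] dX eY] XK XY.
have [T1 hT1] := delay_eventually T d1.
have [T2 hT2] := delay_eventually T d2.
have [T3 hT3] := delay_eventually T d3.
pose S := Num.max T (Num.max T1 (Num.max T2 T3)).
have ST : T <= S by rewrite /S le_max lexx.
have ST1 : T1 <= S by rewrite /S !le_max lexx !orbT.
have ST2 : T2 <= S by rewrite /S !le_max lexx !orbT.
have ST3 : T3 <= S by rewrite /S !le_max lexx !orbT.
have Xb t j : T <= t -> X t j 0 <= (s *: v) j 0.
  by move=> h; rewrite mxE; exact: (XY t h).1.
have Yb t j : T <= t -> Y t j 0 <= (s *: w) j 0.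
  by move=> h; rewrite mxE; exact: (XY t h).2.
have Yd i t : S <= t -> Y t i 0 <= (1 - ka) * s * w i 0.
  move=> St; apply: (le_trans (eY i t (le_trans ST St))).
  have h1 : (C *m X t) i 0 <= (C *m (s *: v)) i 0.
    by apply: mulmx_mono => // j; apply: Xb; exact: le_trans St.
  have h3 : (D *m Y (t - tau3 t)) i 0 <= (D *m (s *: w)) i 0.
    by apply: mulmx_mono => // j; apply: Yb; apply: hT3; exact: le_trans St.
  have := kaP (Some (inr i)); rewrite /m ler_pdivlMr// => h4.
  have h5 : s * (ka * w i 0) <= s * (w i 0 - (C *m v + D *m w) i 0) by rewrite ler_pM2l.
  move: h1 h3 h5; rewrite -!scalemxAr ![(_ *: _ : 'cV[R]_n) i 0]mxE ![(_ + _ : 'cV[R]_n) i 0]mxE.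
  by rewrite [(0 : 'cV[R]_n) i 0]mxE; lra.
have Xd i : exists T', forall t, T' <= t -> X t i 0 <= (1 - ka) * s * v i 0.
  pose L := s * ((A *m v + B *m v + E *m w) i 0 - A i i * v i 0).
  apply: (@caputo_asymp_bound _ (alpha i) (- A i i) K S L _ (fun t => X t i 0)) => //.
  - by rewrite oppr_gt0.
  - exact: le_trans ST.
  - by move=> t t0; exact: XK.
  - move=> t St; have Tt := le_lt_trans ST St.
    have [h1 h2] := dX i t Tt; split=> //; apply: (le_trans h2).
    have a1 : (A *m X t) i 0 <= (A *m (s *: v)) i 0 + A i i * (X t i 0 - (s *: v) i 0).
      by apply: metzler_mono => // j; apply: Xb; exact: ltW.
    have a2 : (B *m X (t - tau1 t)) i 0 <= (B *m (s *: v)) i 0.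
      by apply: mulmx_mono => // j; apply: Xb; apply: hT1; exact/ltW/(le_lt_trans ST1).
    have a3 : (E *m Y (t - tau2 t)) i 0 <= (E *m (s *: w)) i 0.
      by apply: mulmx_mono => // j; apply: Yb; apply: hT2; exact/ltW/(le_lt_trans ST2).
    move: a1 a2 a3; rewrite /L -!scalemxAr ![(_ *: _ : 'cV[R]_d) i 0]mxE ![(_ + _ : 'cV[R]_d) i 0]mxE.
    by rewrite [(0 : 'cV[R]_d) i 0]mxE; lra.
  - have := kaP (Some (inl i)); rewrite /m.
    set q := (_ + _ : 'cV[R]_d) i 0; have q0 : q < 0 by exact: hv.
    have av : 0 < - A i i * v i 0 by rewrite mulr_gt0// oppr_gt0.
    rewrite ler_pdivlMr// ler_pdivlMr// => h.
    have h2 : s * (ka * 2 * (- A i i * v i 0)) <= s * - q by rewrite ler_pM2l.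
    have : s * q < 0 by rewrite pmulr_rlt0.
    rewrite /L -/q; lra.
have [T'] := @finite_upward R _ (fun i T' => forall t, T' <= t -> X t i 0 <= (1 - ka) * s * v i 0)
   (fun i a b ab h t bt => h t (le_trans ab bt)) Xd.
move=> hT'; exists (Num.max S T') => t; rewrite ge_max => /andP[St T't].
by split=> i; [exact: hT'|exact: Yd].
Qed.

Lemma subsystem_decay (R : realType) (d n : nat) (r : R) (alpha : 'I_d -> R)
    (A B : 'M[R]_d) (E : 'M[R]_(d, n)) (C : 'M[R]_(n, d)) (D : 'M[R]_n)
    (tau1 tau2 tau3 : R -> R) (T : R) (F : 'cV[R]_d) (G : 'cV[R]_n)
    (X : R -> 'cV[R]_d) (Y : R -> 'cV[R]_n) :
  0 < r -> (forall i, 0 < alpha i <= 1) ->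
  delay r tau1 -> delay r tau2 -> delay r tau3 ->
  metzler A -> nonneg_mx B -> nonneg_mx C -> nonneg_mx D -> nonneg_mx E ->
  hurwitz (A + B + E *m invmx (1%:M - D) *m C) ->
  (forall i, \sum_j `|D i j| < 1) ->
  subsystem alpha A B E C D tau1 tau2 tau3 0 F G X Y ->
  0 <= T -> subsystem alpha A B E C D tau1 tau2 tau3 T 0 0 X Y ->
  forall eps, 0 < eps -> exists T', forall t, T' <= t ->
     (forall i, X t i 0 <= eps) /\ (forall i, Y t i 0 <= eps).
Proof.
move=> r0 ha d1 d2 d3 mA B0 C0 D0 E0 hM D1 sF T0 s0.
have [v [w [v0 w0 hv hw]]] := positive_direction mA B0 C0 D0 E0 hM D1.
have [K K0 hK] := subsystem_bounded r0 ha d1 d2 d3 mA B0 C0 D0 E0 v0 w0 hv hw sF.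
have [th /andP[th0 th1] thP] :=
  subsystem_contract ha d1 d2 d3 mA B0 C0 D0 E0 v0 w0 hv hw.
pose N := 1 + (\sum_i `|v i 0| + \sum_i `|w i 0|).
have sv0 : 0 <= \sum_i `|v i 0| by rewrite sumr_ge0.
have sw0 : 0 <= \sum_i `|w i 0| by rewrite sumr_ge0.
have N0 : 0 < N by rewrite ltr_wpDr// addr_ge0.
have vN i : v i 0 <= N.
  by have := ler_norm (v i 0); have := ler_norm_sum_mem (fun i => v i 0) i; rewrite /N /=; lra.
have wN i : w i 0 <= N.
  by have := ler_norm (w i 0); have := ler_norm_sum_mem (fun i => w i 0) i; rewrite /N /=; lra.
have rneg t : 0 <= t -> - r <= t by move=> t0; rewrite (le_trans _ t0)// oppr_le0 ltW.
have XK t i : 0 <= t -> X t i 0 <= K * N.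
  move=> t0; apply: le_trans ((hK t (rneg t t0)).1 i) _.
  by rewrite ler_pM2l.
have iter k : exists T', T <= T' /\ forall t, T' <= t ->
    (forall i, X t i 0 <= th ^+ k * K * v i 0) /\ (forall i, Y t i 0 <= th ^+ k * K * w i 0).
  elim: k => [|k [T' [TT' IH]]].
    exists T; split=> // t Tt; rewrite expr0 mul1r; apply: hK.
    by rewrite rneg// (le_trans T0).
  have sT' : subsystem alpha A B E C D tau1 tau2 tau3 T' 0 0 X Y.
    case: s0 => c0 h1 h2; split=> // i t ht; [apply: h1|apply: h2].
      exact: le_lt_trans ht.
    exact: le_trans ht.
  have thK : 0 < th ^+ k * K by rewrite mulr_gt0// exprn_gt0.
  have [T'' hT''] := thP T' _ (K * N) X Y (le_trans T0 TT') thK sT' XK IH.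
  exists (Num.max T T''); split; first by rewrite le_max lexx.
  by move=> t; rewrite ge_max => /andP[_ /hT'']; rewrite exprS -mulrA.
move=> eps eps0.
have e1 : 0 < eps / (K * N) by rewrite divr_gt0// mulr_gt0.
have [k hk] : exists k, th ^+ k < eps / (K * N).
  have thn : `|th| < 1 by rewrite ger0_norm// ltW.
  have /cvgrPdist_lt/(_ _ e1)[k _ hk] := cvg_expr thn.
  exists k; have := hk k (leqnn k); rewrite /= sub0r normrN.
  by apply: le_lt_trans; exact: ler_norm.
have [T' [_ hT']] := iter k; exists T' => t /hT'[hX hY].
have key u : 0 < u -> u <= N -> th ^+ k * K * u <= eps.
  move=> u0 uN; apply: (@le_trans _ _ (th ^+ k * (K * N))).
    by rewrite -mulrA ler_pM2l ?exprn_gt0// ler_pM2l.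
  by rewrite -ler_pdivlMr ?mulr_gt0// ltW.
by split=> i; [apply: le_trans (hX i) _|apply: le_trans (hY i) _]; apply: key.
Qed.

(** * Deviation of the solutions from the equilibrium *)

Lemma equilibrium_eq (R : realType) d n (A B : 'M[R]_d) (E : 'M[R]_(d, n)) (C : 'M[R]_(n, d))
    (D : 'M[R]_n) (F : 'cV[R]_d) (G : 'cV[R]_n) :
  hurwitz (A + B + E *m invmx (1%:M - D) *m C) -> 1%:M - D \in unitmx ->
  let xs := - (invmx (A + B + E *m invmx (1%:M - D) *m C)
                  *m (F + E *m invmx (1%:M - D) *m G)) in
  let ys := invmx (1%:M - D) *m (C *m xs + G) in
  A *m xs + B *m xs + E *m ys + F = 0 /\ ys = C *m xs + D *m ys + G.
Proof.
move=> hM U; set H := invmx (1%:M - D) in hM *.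
set M := A + B + E *m H *m C in hM *; move=> xs ys.
have UM : M \in unitmx.
  by have := hurwitz_unit hM (lexx 0); rewrite raddf0 sub0r -scaleN1r unitmxZ// unitrN1.
split.
  have : M *m xs = - (F + E *m H *m G) by rewrite /xs mulmxN mulKVmx.
  rewrite /M !mulmxDl => e.
  have -> : E *m ys = E *m H *m C *m xs + E *m H *m G.
    by rewrite /ys mulmxA mulmxDr !mulmxA.
  by rewrite addrA e opprD subrK addNr.
have : (1%:M - D) *m ys = C *m xs + G by rewrite /ys mulKVmx.
rewrite mulmxBl mul1mx => /eqP; rewrite subr_eq => /eqP {1}->.
by rewrite addrAC.
Qed.

Lemma deviation_rhs (R : realType) d n (A B : 'M[R]_d) (E : 'M[R]_(d, n))
    (x x1 xs f F : 'cV[R]_d) (y ys : 'cV[R]_n) :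
  A *m xs + B *m xs + E *m ys + F = 0 ->
  A *m x + B *m x1 + E *m y + f =
  A *m (x - xs) + B *m (x1 - xs) + E *m (y - ys) + (f - F).
Proof.
rewrite !mulmxBr; move: (A *m x) (B *m x1) (E *m y) (A *m xs) (B *m xs) (E *m ys).
move=> a b e a' b' e' h; apply/matrixP => i j; have := congr1 (fun V : 'cV[R]_d => V i j) h.
by rewrite /= !mxE; lra.
Qed.

Lemma deviation_output (R : realType) d n (C : 'M[R]_(n, d)) (D : 'M[R]_n)
    (x xs : 'cV[R]_d) (y ys g G : 'cV[R]_n) :
  ys = C *m xs + D *m ys + G ->
  C *m x + D *m y + g - ys = C *m (x - xs) + D *m (y - ys) + (g - G).
Proof.
rewrite !mulmxBr; move: (C *m x) (D *m y) (C *m xs) (D *m ys) => a b a' b' h.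
apply/matrixP => i j; have := congr1 (fun V : 'cV[R]_n => V i j) h.
by rewrite /= !mxE; lra.
Qed.

(** Functions that are continuous on a half-line are handled through their
    extension by a constant, which is continuous everywhere. *)
Lemma continuous_clamp (R : realType) (U : topologicalType) (a : R) (f : R -> U) :
  {within `[a, +oo[, continuous f} -> continuous (fun t => f (Num.max a t)).
Proof.
move=> cf t P Pf.
have Aa : `[a, +oo[%classic (Num.max a t) by rewrite /= in_itv/= le_max lexx.
have hP : within `[a, +oo[%classic (nbhs (Num.max a t)) (f @^-1` P).
  by rewrite (nbhs_subspace_in Aa); exact: cf Pf.
have cm : {for t, continuous (fun s : R => Num.max a (s - 0))} by exact: continuous_ramp.
have cm' : (fun s : R => Num.max a (s - 0)) = (fun s => Num.max a s).
  by apply/funext => s; rewrite subr0.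
rewrite cm' in cm.
have h2 : \forall s \near t, `[a, +oo[%classic (Num.max a s) -> P (f (Num.max a s)).
  exact: cm hP.
change (\forall s \near t, P (f (Num.max a s))).
apply: filterS h2 => s; apply.
by rewrite /= in_itv/= le_max lexx.
Qed.

Lemma solution_deviation (R : realType) (d n : nat) (r : R) (alpha : 'I_d -> R)
    (A B : 'M[R]_d) (E : 'M[R]_(d, n)) (C : 'M[R]_(n, d)) (D : 'M[R]_n)
    (tau1 tau2 tau3 : R -> R) (f : R -> 'cV[R]_d) (g : R -> 'cV[R]_n)
    (psi : R -> 'cV[R]_d) (phi : R -> 'cV[R]_n) (z : R -> 'cV[R]_(d + n))
    (F xs : 'cV[R]_d) (G ys : 'cV[R]_n) :
  0 < r ->
  delay r tau1 -> delay r tau2 -> delay r tau3 ->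
  is_solution r alpha A B E C D tau1 tau2 tau3 f g psi phi z ->
  A *m xs + B *m xs + E *m ys + F = 0 -> ys = C *m xs + D *m ys + G ->
  exists X : R -> 'cV[R]_d, exists Y : R -> 'cV[R]_n,
  [/\ (forall i, continuous (fun t => X t i 0)) /\ (forall i, continuous (fun t => Y t i 0)),
      forall i t, 0 < t -> caputo_derivable (alpha i) (fun s => X s i 0) t /\
         caputo (alpha i) (fun s => X s i 0) t =
           (A *m X t + B *m X (t - tau1 t) + E *m Y (t - tau2 t) + (f t - F)) i 0,
      forall i t, 0 <= t -> Y t i 0 = (C *m X t + D *m Y (t - tau3 t) + (g t - G)) i 0
    & forall t, 0 <= t -> z t = col_mx (X t) (Y t) + col_mx xs ys].
Proof.
move=> r0 [_ _ t1r _] [_ _ t2r _] [_ _ t3r _] [cz dz yz _] xsE ysE.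
pose zc t := z (Num.max (- r) t).
have czc : continuous zc by exact: continuous_clamp.
have zcE t : - r <= t -> zc t = z t by move=> h; rewrite /zc max_r.
clearbody zc.
have nr t : 0 <= t -> - r <= t by move=> t0; rewrite (le_trans _ t0)// oppr_le0 ltW.
exists (fun t => usubmx (zc t) - xs), (fun t => dsubmx (zc t) - ys); split.
- have cc k : continuous (fun t => zc t k 0).
    by move=> t; apply: (@continuous_comp _ _ _ zc (fun M : 'cV[R]_(d + n) => M k 0));
      [exact: czc|exact: coord_continuous].
  split=> i t; [under eq_fun do rewrite 2!mxE [(- xs) i 0]mxE
               |under eq_fun do rewrite 2!mxE [(- ys) i 0]mxE];
  by apply: cvgB; [exact: cc|exact: cvg_cst].
- move=> i t t0; have [dx ex] := dz t t0.
  have eqx s : 0 <= s -> usubmx (z s) i 0 = usubmx (zc s) i 0 by move=> s0; rewrite zcE// nr.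
  have [h1 h2] := caputo_eq eqx t0 (dx i).
  rewrite /caputo_derivable /caputo.
  under [X in caputo_prim _ X]eq_fun do rewrite mxE [(- xs) i 0]mxE.
  rewrite caputo_prim_shift; split; first exact: h1.
  rewrite -/(caputo _ _ _) h2.
  have := congr1 (fun V : 'cV[R]_d => V i 0) ex; rewrite mxE => ->.
  rewrite (zcE _ (nr _ (ltW t0))) (zcE _ (t1r _ (ltW t0))) (zcE _ (t2r _ (ltW t0))).
  by rewrite (deviation_rhs _ _ _ _ xsE).
- move=> i t t0; rewrite (zcE _ (nr _ t0)) (zcE _ (t3r _ t0)) yz//.
  by rewrite (deviation_output _ _ _ ysE).
- by move=> t t0; rewrite add_col_mx !subrK vsubmxK zcE// nr.
Qed.

Lemma solution_upper (R : realType) (d n : nat) (r : R) (alpha : 'I_d -> R)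
    (A B : 'M[R]_d) (E : 'M[R]_(d, n)) (C : 'M[R]_(n, d)) (D : 'M[R]_n)
    (tau1 tau2 tau3 : R -> R) (f : R -> 'cV[R]_d) (g : R -> 'cV[R]_n)
    (psi : R -> 'cV[R]_d) (phi : R -> 'cV[R]_n) (z : R -> 'cV[R]_(d + n))
    (F xs : 'cV[R]_d) (G ys : 'cV[R]_n) :
  0 < r -> (forall i, 0 < alpha i <= 1) ->
  delay r tau1 -> delay r tau2 -> delay r tau3 ->
  metzler A -> nonneg_mx B -> nonneg_mx C -> nonneg_mx D -> nonneg_mx E ->
  hurwitz (A + B + E *m invmx (1%:M - D) *m C) ->
  (forall i, \sum_j `|D i j| < 1) ->
  is_solution r alpha A B E C D tau1 tau2 tau3 f g psi phi z ->
  A *m xs + B *m xs + E *m ys + F = 0 -> ys = C *m xs + D *m ys + G ->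
  (forall t, 0 <= t -> lemx (f t) F) -> (forall t, 0 <= t -> lemx (g t) G) ->
  forall eps, 0 < eps -> exists T, forall t, T <= t ->
    forall k, z t k 0 <= col_mx xs ys k 0 + eps.
Proof.
move=> r0 ha d1 d2 d3 mA B0 C0 D0 E0 hM D1 sol xsE ysE fF gG eps eps0.
have [X [Y [cXY dX eY zE]]] := solution_deviation r0 d1 d2 d3 sol xsE ysE.
have sub : subsystem alpha A B E C D tau1 tau2 tau3 0 0 0 X Y.
  split=> // i t t0.
    have [h1 ->] := dX i t t0; split=> //.
    rewrite [leLHS]mxE [leRHS]mxE lerD2l !mxE subr_le0; exact/fF/ltW.
  by rewrite eY// [leLHS]mxE [leRHS]mxE lerD2l !mxE subr_le0; exact: gG.
have [T hT] := subsystem_decay r0 ha d1 d2 d3 mA B0 C0 D0 E0 hM D1 sub (lexx 0) sub eps0.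
exists (Num.max 0 T) => t; rewrite ge_max => /andP[t0 /hT[hX hY]] k.
rewrite zE// mxE addrC lerD2l -(splitK k); case: (fintype.split k) => i.
  by rewrite /= col_mxEu.
by rewrite /= col_mxEd.
Qed.

(** When f = F and g = G from time T0 on, the opposite of the deviation is a
    subsolution of the homogeneous system after T0.  Before T0, it is a subsolution
    with the inputs F and G, which is enough for its boundedness. *)
Lemma solution_lower (R : realType) (d n : nat) (r : R) (alpha : 'I_d -> R)
    (A B : 'M[R]_d) (E : 'M[R]_(d, n)) (C : 'M[R]_(n, d)) (D : 'M[R]_n)
    (tau1 tau2 tau3 : R -> R) (f : R -> 'cV[R]_d) (g : R -> 'cV[R]_n)
    (psi : R -> 'cV[R]_d) (phi : R -> 'cV[R]_n) (z : R -> 'cV[R]_(d + n))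
    (F xs : 'cV[R]_d) (G ys : 'cV[R]_n) (T0 : R) :
  0 < r -> (forall i, 0 < alpha i <= 1) ->
  delay r tau1 -> delay r tau2 -> delay r tau3 ->
  metzler A -> nonneg_mx B -> nonneg_mx C -> nonneg_mx D -> nonneg_mx E ->
  hurwitz (A + B + E *m invmx (1%:M - D) *m C) ->
  (forall i, \sum_j `|D i j| < 1) ->
  is_solution r alpha A B E C D tau1 tau2 tau3 f g psi phi z ->
  A *m xs + B *m xs + E *m ys + F = 0 -> ys = C *m xs + D *m ys + G ->
  (forall t, 0 <= t -> nonneg_mx (f t)) -> (forall t, 0 <= t -> nonneg_mx (g t)) ->
  0 <= T0 -> (forall t, T0 <= t -> f t = F /\ g t = G) ->
  forall eps, 0 < eps -> exists T, forall t, T <= t ->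
    forall k, col_mx xs ys k 0 - eps <= z t k 0.
Proof.
move=> r0 ha d1 d2 d3 mA B0 C0 D0 E0 hM D1 sol xsE ysE f0 g0 T00 fgE eps eps0.
have [X [Y [[cX cY] dX eY zE]]] := solution_deviation r0 d1 d2 d3 sol xsE ysE.
pose X' t := - X t; pose Y' t := - Y t.
have cX' i : continuous (fun t => X' t i 0).
  by under eq_fun do rewrite mxE; move=> t; apply: cvgN; exact: cX.
have cY' i : continuous (fun t => Y' t i 0).
  by under eq_fun do rewrite mxE; move=> t; apply: cvgN; exact: cY.
have dX' i t : 0 < t -> caputo_derivable (alpha i) (fun s => X' s i 0) t /\
     caputo (alpha i) (fun s => X' s i 0) t =
       (A *m X' t + B *m X' (t - tau1 t) + E *m Y' (t - tau2 t) + (F - f t)) i 0.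
  move=> t0; have [h1 h2] := dX i t t0.
  have [h3 h4] := caputoN (ha i) (cX i) h1.
  have e : (fun s => X' s i 0) = (fun s => - X s i 0) by apply/funext => s; rewrite mxE.
  rewrite e; split=> //; rewrite h4 h2 /X' /Y' !mulmxN -(opprB (f t)) -!opprD.
  by rewrite [RHS]mxE.
have eY' i t : 0 <= t ->
   Y' t i 0 = (C *m X' t + D *m Y' (t - tau3 t) + (G - g t)) i 0.
  by move=> t0; rewrite /Y' /X' mxE eY// !mulmxN -(opprB (g t)) -!opprD [RHS]mxE.
have sub0 : subsystem alpha A B E C D tau1 tau2 tau3 0 F G X' Y'.
  split=> // i t t0.
    have [h1 ->] := dX' i t t0; split=> //.
    rewrite [leLHS]mxE [leRHS]mxE lerD2l !mxE gerBl; exact/f0/ltW.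
  by rewrite eY'// [leLHS]mxE [leRHS]mxE lerD2l !mxE gerBl; exact: g0.
have sub1 : subsystem alpha A B E C D tau1 tau2 tau3 T0 0 0 X' Y'.
  split=> // i t Tt.
    have [h1 ->] := dX' i t (le_lt_trans T00 Tt); split=> //.
    by rewrite (fgE t (ltW Tt)).1 subrr.
  by rewrite eY' ?(fgE t Tt).2 ?subrr// (le_trans T00).
have [T hT] := subsystem_decay r0 ha d1 d2 d3 mA B0 C0 D0 E0 hM D1 sub0 T00 sub1 eps0.
exists (Num.max 0 T) => t; rewrite ge_max => /andP[t0 /hT[hX hY]] k.
rewrite zE// [leRHS]mxE [leRHS]addrC lerD2l -(splitK k); case: (fintype.split k) => i.
  by rewrite /= col_mxEu lerNl; have := hX i; rewrite mxE.
by rewrite /= col_mxEd lerNl; have := hY i; rewrite mxE.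
Qed.

(** * The supremum of the upper limits *)

Lemma limsup_le (R : realType) (u : R -> R) (c : R) :
  (forall eps, 0 < eps -> exists T, forall t, T <= t -> u t <= c + eps) ->
  (limsup_pinfty u <= c%:E)%E.
Proof.
move=> h; apply/lee_addgt0Pr => eps eps0; have [T hT] := h _ eps0.
apply: ge_ereal_inf; exists (ereal_sup ((fun t => (u t)%:E) @` [set t | T < t])).
  by exists [set t | T < t] => //; exists T; split; [exact: num_real|].
by apply: ge_ereal_sup => _ [t /= /ltW Tt <-]; rewrite -EFinD lee_fin hT.
Qed.

Lemma limsup_ge (R : realType) (u : R -> R) (c : R) :
  (forall eps, 0 < eps -> exists T, forall t, T <= t -> c - eps <= u t) ->
  (c%:E <= limsup_pinfty u)%E.
Proof.
move=> h; apply: le_ereal_inf_tmp => _ [P [M [_ hM]] <-].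
apply/lee_subgt0Pr => eps eps0; have [T hT] := h _ eps0.
pose t := Num.max T (M + 1).
apply: le_ereal_sup_tmp; exists (u t)%:E.
  by exists t => //; apply: hM; rewrite lt_max ltrDl ltr01 orbT.
by rewrite -EFinB lee_fin hT// le_max lexx.
Qed.

Lemma sup_vec_ub (R : realType) m (f : R -> 'cV[R]_m) t i :
  bounded_vec `[0, +oo[ f -> 0 <= t -> f t i 0 <= sup_vec `[0, +oo[ f i 0.
Proof.
move=> [K hK] t0; rewrite mxE; apply: ub_le_sup; last first.
  by exists t => //=; rewrite in_itv/= t0.
exists K => _ [s hs <-]; exact: le_trans (ler_norm _) (hK s hs i).
Qed.

(** The segment from g0 to G, described during the time interval [0, 1]. *)
Lemma compat_input_path (R : realType) m (g0 G : 'cV[R]_m) :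
  nonneg_mx g0 -> lemx g0 G ->
  exists g : R -> 'cV[R]_m, [/\ cont_nonneg `[0, +oo[ g, forall t, 0 <= t -> lemx (g t) G,
    g 0 = g0 & forall t, 1 <= t -> g t = G].
Proof.
move=> g00 g0G; pose c t : R := Num.max 0 (- t - (- 1)).
have cc : continuous c.
  move=> t; apply: (@continuous_comp _ _ _ (fun t : R => - t) (fun s => Num.max 0 (s - (- 1)))).
    by apply: cvgN; exact: cvg_id.
  exact: continuous_ramp.
have c0 t : 0 <= c t by rewrite /c le_max lexx.
have c1 t : 0 <= t -> c t <= 1 by move=> t0; rewrite /c ge_max ler01/=; lra.
exists (fun t => G - c t *: (G - g0)); split.
- split.
    apply: continuous_subspaceT => t; apply: cvgB; first exact: cvg_cst.
    by apply: cvgZr_tmp; exact: cc.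
  move=> t; rewrite /= in_itv/= andbT => t0 i j; rewrite !mxE.
  have := g00 i j; have := g0G i j; have := c0 t; have := c1 t t0; move: (c t) => k k1 k0 a b.
  have : 0 <= (1 - k) * (G i j - g0 i j) by rewrite mulr_ge0 ?subr_ge0.
  lra.
- move=> t t0 i j; rewrite !mxE lerBlDr lerDl mulr_ge0// subr_ge0.
  exact: g0G.
- have -> : c 0 = 1 by rewrite /c max_r; lra.
  by rewrite scale1r subKr.
- move=> t t1; have -> : c t = 0 by rewrite /c max_l//; lra.
  by rewrite scale0r subr0.
Qed.

Lemma cst_input_class (R : realType) m (F : 'cV[R]_m) : nonneg_mx F ->
  input_class F (fun=> F).
Proof.
move=> F0; split; last by move=> t _ i j.
by split=> [|t _ //]; apply: continuous_subspaceT; exact: cst_continuous.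
Qed.

Unset Implicit Arguments.
Set Strict Implicit.

Theorem theorem5p7 (R : realType) (d n : nat) (r : R) (alpha : 'I_d -> R)
    (A B : 'M[R]_d) (E : 'M[R]_(d, n)) (C : 'M[R]_(n, d)) (D : 'M[R]_n)
    (tau1 tau2 tau3 : R -> R)
    (f0 : R -> 'cV[R]_d) (g0 : R -> 'cV[R]_n)
    (psi : R -> 'cV[R]_d) (phi : R -> 'cV[R]_n)
    (Phi : (R -> 'cV[R]_d) -> (R -> 'cV[R]_n) -> R -> 'cV[R]_(d + n)) :
  0 < r ->
  (forall i, 0 < alpha i <= 1) ->
  delay r tau1 -> delay r tau2 -> delay r tau3 ->
  metzler A ->
  nonneg_mx B -> nonneg_mx C -> nonneg_mx D -> nonneg_mx E ->
  hurwitz (A + B + E *m invmx (1%:M - D) *m C) ->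
  (forall i, \sum_k `|C i k| < 1 /\ \sum_j `|D i j| < 1) ->
  (forall i, exists j, 0 < (invmx (1%:M - D) *m C) i j) ->
  cont_nonneg `[0, +oo[ f0 -> bounded_vec `[0, +oo[ f0 ->
  cont_nonneg `[0, +oo[ g0 -> bounded_vec `[0, +oo[ g0 ->
  cont_nonneg `[- r, 0] psi -> cont_nonneg `[- r, 0] phi ->
  C *m psi 0 + D *m phi (- tau3 0) + g0 0 = phi 0 ->
  let F := sup_vec `[0, +oo[ f0 in
  let G := sup_vec `[0, +oo[ g0 in
  let calF := input_class F in
  let calG := compat_input_class G C D (psi 0) (phi (- tau3 0)) (phi 0) in
  (forall f g, calF f -> calG g ->
    is_solution r alpha A B E C D tau1 tau2 tau3 f g psi phi (Phi f g)) ->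
  let xstar := - (invmx (A + B + E *m invmx (1%:M - D) *m C)
                  *m (F + E *m invmx (1%:M - D) *m G)) in
  let ystar := invmx (1%:M - D) *m (C *m xstar + G) in
  forall i : 'I_(d + n),
    ereal_sup [set limsup_pinfty (fun t => Phi fg.1 fg.2 t i 0)
              | fg in calF `*` calG]
    = (col_mx xstar ystar i 0)%:E.
Proof.
move=> r0 ha d1 d2 d3 mA B0 C0 D0 E0 hM rows _ [cf0 f0p] f0b [cg0 g0p] g0b _ _ compat.
move=> F G calF calG sol xstar ystar i.
have D1 k : \sum_j `|D k j| < 1 by exact: (rows k).2.
have [U _] := invmx_1B_nonneg D0 D1.
have [xsE ysE] := @equilibrium_eq _ _ _ A B E C D F G hM U.
have in0 : `[0, +oo[%classic (0 : R) by rewrite /= in_itv/= lexx.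
have F0 : nonneg_mx F.
  by move=> k j; rewrite (ord1 j) (le_trans (f0p 0 in0 k 0))// sup_vec_ub.
have g0G : lemx (g0 0) G by move=> k j; rewrite (ord1 j) sup_vec_ub.
have ge0in (t : R) : 0 <= t -> `[0, +oo[%classic t by move=> t0; rewrite /= in_itv/= t0.
apply/eqP; rewrite eq_le; apply/andP; split.
  apply: ge_ereal_sup => _ [[f g] [/= Ff Gg] <-].
  apply: limsup_le => eps eps0.
  have [T hT] := solution_upper r0 ha d1 d2 d3 mA B0 C0 D0 E0 hM D1
    (sol f g Ff Gg) xsE ysE Ff.2 Gg.1.2 eps0.
  by exists T => t /hT; apply.
have [g [cg gG g0E g1E]] := compat_input_path (g0p 0 in0) g0G.
have Ff := cst_input_class F0.
have Gg : calG g by split; [split|rewrite g0E].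
apply: le_ereal_sup_tmp; exists (limsup_pinfty (fun t => Phi (fun=> F) g t i 0)).
  by exists ((fun=> F), g).
apply: limsup_ge => eps eps0.
have [T hT] := solution_lower r0 ha d1 d2 d3 mA B0 C0 D0 E0 hM D1
  (sol _ _ Ff Gg) xsE ysE (fun t _ => F0) (fun t t0 => cg.2 t (ge0in t t0)) ler01
  (fun t t1 => conj erefl (g1E t t1)) eps0.
by exists T => t /hT; apply.
Qed.
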